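(* Let $\Omega=\{x_1,\dots,x_n\}$ be a set of $n$ distinct points of $\mathbb{R}$, let $1\le m\le n$, and let $\boldsymbol{L}_\varepsilon=[\kappa_\varepsilon(x_i,x_j)]_{i,j=1}^n$ with $\kappa$ a stationary kernel of smoothness order $r\le m$. Then, as $\varepsilon\to0$ ($\varepsilon>0$), $\mathcal{X}_\varepsilon\sim|DPP|_m(\boldsymbol{L}_\varepsilon)$ converges to $\mathcal{X}_\star\sim|DPP|_m\big((-1)^r\boldsymbol{D}^{(2r-1)};\boldsymbol{V}_{\le r-1}\big)$.
   Context: Kernel: a positive definite function $\kappa:\mathbb{R}\times\mathbb{R}\to\mathbb{R}$ (the matrix $[\kappa(y_i,y_j)]_{i,j}$ is positive definite for any finitely many distinct points $y_i$). It is stationary if $\kappa(x,y)=f(|x-y|)$ for a function $f$; $f$ is assumed analytic in a neighbourhood of $0$, $f(t)=\sum_{i\ge0}f_it^i$ with $f_i=f^{(i)}(0)/i!$, and $\kappa_\varepsilon(x,y)=f(\varepsilon|x-y|)$. Smoothness order: $r=\min\{r\ge1: f_{2r-1}\neq0\}$, with $r=\infty$ if all odd coefficients vanish. $\boldsymbol{V}_{\le k}=[x_i^{j}]_{1\le i\le n,\,0\le j\le k}\in\mathbb{R}^{n\times(k+1)}$ is the Vandermonde matrix and $\boldsymbol{D}^{(s)}=[|x_i-x_j|^s]_{i,j=1}^n$. Fixed-size L-ensemble: $\mathcal{X}\sim|DPP|_m(\boldsymbol{L})$, $\boldsymbol{L}$ positive semi-definite, means $\mathbf{P}(\mathcal{X}=X)\propto\det(\boldsymbol{L}_X)$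 if $|X|=m$, and $0$ otherwise. Fixed-size partial-projection DPP: for $\boldsymbol{L}$ symmetric and $\boldsymbol{V}\in\mathbb{R}^{n\times p}$ of full column rank such that $\boldsymbol{x}^\top\boldsymbol{L}\boldsymbol{x}\ge0$ whenever $\boldsymbol{V}^\top\boldsymbol{x}=0$, $\mathcal{X}\sim|DPP|_m(\boldsymbol{L};\boldsymbol{V})$ means $\mathbf{P}(\mathcal{X}=X)\propto(-1)^p\det\begin{pmatrix}\boldsymbol{L}_X&\boldsymbol{V}_{X,:}\\(\boldsymbol{V}_{X,:})^\top&\boldsymbol{0}\end{pmatrix}$ if $|X|=m$, and $0$ otherwise. Here $\boldsymbol{L}_X$ is the principal submatrix indexed by $X$ and $\boldsymbol{V}_{X,:}$ the submatrix of rows in $X$. Convergence: $\mathbf{P}(\mathcal{X}_\varepsilon=X)\to\mathbf{P}(\mathcal{X}_\star=X)$ for every $X\subseteq\Omega$. *)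

(* Defs.v *)
From HB Require Import structures.
From mathcomp Require Import all_boot all_order all_algebra.
From mathcomp Require Import all_classical all_reals all_analysis.

Set Implicit Arguments.
Unset Strict Implicit.
Unset Printing Implicit Defensive.

Import Order.TTheory GRing.Theory Num.Theory.
Import numFieldNormedType.Exports.

Local Open Scope classical_set_scope.
Local Open Scope ring_scope.

Definition psdmx (R : realType) (n : nat) (A : 'M[R]_n) : Prop :=
  A^T = A /\ forall v : 'cV[R]_n, 0 <= (v^T *m A *m v) 0 0.

Definition pdmx (R : realType) (n : nat) (A : 'M[R]_n) : Prop :=
  A^T = A /\ forall v : 'cV[R]_n, v != 0 -> 0 < (v^T *m A *m v) 0 0.

Definition kernel_mx (R : realType) (n : nat) (k : R -> R -> R)
    (x : 'I_n -> R) : 'M[R]_n :=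
  \matrix_(i, j) k (x i) (x j).

Definition pd_kernel (R : realType) (k : R -> R -> R) : Prop :=
  forall (n : nat) (y : 'I_n -> R), injective y -> pdmx (kernel_mx k y).

Definition stationary (R : realType) (k : R -> R -> R) (f : R -> R) : Prop :=
  forall x y, k x y = f `|x - y|.

(* Agrees with (x, y) |-> k (eps * x) (eps * y) when k is stationary with
   profile f and eps >= 0. *)
Definition scaled_kernel (R : realType) (f : R -> R) (eps : R) : R -> R -> R :=
  fun x y => f (eps * `|x - y|).

Definition taylor_coef (R : realType) (f : R -> R) (i : nat) : R :=
  derive1n i f 0 / i`!%:R.

(* In MathComp-Analysis, derivatives are total functions with a junk value where
   they do not exist; the convergence of this expansion near 0 forces f to be
   smooth near 0, so that the coefficients are the genuine ones. *)
Definition analytic_at0 (R : realType) (f : R -> R) : Prop :=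
  \forall t \near (0 : R), pseries (taylor_coef f) t @ \oo --> f t.

(* The smoothness order is finite and equal to r. *)
Definition smoothness_order (R : realType) (f : R -> R) (r : nat) : Prop :=
  [/\ (1 <= r)%N,
      taylor_coef f (2 * r - 1)%N != 0
    & forall s : nat, (1 <= s < r)%N -> taylor_coef f (2 * s - 1)%N = 0].

(* The n x (k + 1) matrix [x_i ^ j]; the library's Vandermonde matrix is its
   transpose. *)
Definition vandermonde_le (R : realType) (n k : nat) (x : 'I_n -> R) :
    'M[R]_(n, k.+1) :=
  (Vandermonde k.+1 (\row_i x i))^T.

Definition dist_mx (R : realType) (n s : nat) (x : 'I_n -> R) : 'M[R]_n :=
  \matrix_(i, j) `|x i - x j| ^+ s.

Definition principal_submx (R : realType) (n : nat) (L : 'M[R]_n)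
    (X : {set 'I_n}) : 'M[R]_#|X| :=
  mxsub (@enum_val _ (mem X)) (@enum_val _ (mem X)) L.

Definition rows_submx (R : realType) (n p : nat) (V : 'M[R]_(n, p))
    (X : {set 'I_n}) : 'M[R]_(#|X|, p) :=
  rowsub (@enum_val _ (mem X)) V.

(* A random subset of Omega = {x_1, ..., x_n} enters only through its law, given
   by P(X) = Prob (the random subset is X); subsets of Omega are encoded by the
   sets of their indices. *)
Definition is_law (R : realType) (n : nat) (P : {set 'I_n} -> R) : Prop :=
  (forall X, 0 <= P X) /\ \sum_X P X = 1.

Definition proportional (R : realType) (T : Type) (P w : T -> R) : Prop :=
  exists c : R, forall X, P X = c * w X.

(* P is the law of |DPP|_m(L). *)
Definition fixed_size_dpp (R : realType) (n m : nat) (L : 'M[R]_n)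
    (P : {set 'I_n} -> R) : Prop :=
  [/\ psdmx L,
      is_law P
    & proportional P (fun X : {set 'I_n} =>
        if #|X| == m then \det (principal_submx L X) else 0)].

(* P is the law of |DPP|_m(L; V). *)
Definition fixed_size_pp_dpp (R : realType) (n m p : nat) (L : 'M[R]_n)
    (V : 'M[R]_(n, p)) (P : {set 'I_n} -> R) : Prop :=
  [/\ L^T = L /\ \rank V = p,
      forall v : 'cV[R]_n, V^T *m v = 0 -> 0 <= (v^T *m L *m v) 0 0,
      is_law P
    & proportional P (fun X : {set 'I_n} =>
        if #|X| == m then
          (-1) ^+ p * \det (block_mx (principal_submx L X) (rows_submx V X)
                                     (rows_submx V X)^T 0)
        else 0)].

(* Main.v *)
Require Import Defs.
From mathcomp Require Import all_boot all_order all_algebra.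
From mathcomp Require Import all_classical all_reals all_analysis.
From mathcomp Require Import ring lra zify.
Import Order.TTheory GRing.Theory Num.Theory.
Import numFieldNormedType.Exports.
Local Open Scope classical_set_scope.
Local Open Scope ring_scope.

Set Implicit Arguments.
Unset Strict Implicit.
Unset Printing Implicit Defensive.

(** Finitely supported signed measures are tested against a profile g through
    [pairing g s t], the sum of s(x) t(y) g(|x - y|) over the atoms x of s and
    y of t; the determinants of the kernel matrices are Gram determinants of
    such pairings. Expanding f gives
      pairing f(eps .) s t = sum_k f_k eps^k pairing (|.|^k) s t.
    An even power |x - y|^(2k) is a polynomial, so its pairing vanishes as soon
    as 2k is below the number of vanishing moments of s plus that of t, and the
    odd powers below 2r - 1 are absent ([pairing_order_cvg]).

    For points y_1, ..., y_m take the measures dual to the monomials, i.e. the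
    rows of the inverse U of the square Vandermonde matrix. In this basis, with
    row i scaled by eps^(- min(i, r - 1)) and column j by eps^(- min(j, r)), the
    kernel matrix tends to a block triangular matrix with diagonal blocks W, the
    Wronskian matrix of f at 0, and f_(2r-1) E, where E is the form of
    |x - y|^(2r-1) on the measures with r vanishing moments. The same change of
    basis turns the saddle-point determinant of the limit law into det E
    ([saddle_weight_dual]). Hence det L_eps(X) ~ eps^d C w(X), where w(X) is the
    limit weight and d, C depend only on |X| ([det_kernel_flat_cvg]); the factor
    eps^d C disappears when the weights are normalized.

    It remains to see that C is nonzero and that w is positive on sets of size
    m. Positivity is obtained from the positivity of the kernel itself. In the
    limit, f_(2r-1) E is positive semidefinite; evaluating E on an r-th finite
    difference gives, up to (-1)^r, a value of a B-spline, so f_(2r-1) has the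
    sign of (-1)^r ([signed_coef_gt0]). If E were degenerate, Cauchy-Schwarz
    would force every 2r-th difference of y |-> sum_i v_i |x_i - y|^(2r-1) to
    vanish, which the kink at x_i forbids ([cond_definite]).

    If W were singular, some combination sum_i a_i f^(i)/i! would be a null
    vector of the reproducing kernel space, and Cauchy-Schwarz would make
    sum_i a_i f^(i)(t)/i! vanish for small t > 0; the Taylor coefficients of this
    relation, together with the vanishing of the lower odd coefficients, give
    f_(2r-1) = 0 ([wronskian_unit]). *)

(** * Pairings of finitely supported signed measures *)

(** A signed measure is the list of its (weight, point) pairs. Points may be
    repeated, so that addition is concatenation. *)
Definition pairing (R : realType) (g : R -> R) (s t : seq (R * R)) : R :=
  \sum_(p <- s) \sum_(q <- t) p.1 * q.1 * g `|p.2 - q.2|.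

Definition moment (R : realType) (a : nat) (s : seq (R * R)) : R :=
  \sum_(p <- s) p.1 * p.2 ^+ a.

Definition vanishing (R : realType) (k : nat) (s : seq (R * R)) : Prop :=
  forall a, (a < k)%N -> moment a s = 0.

Definition scale_meas (R : realType) (c : R) (s : seq (R * R)) :=
  [seq (c * p.1, p.2) | p <- s].

Definition meas (R : realType) (n : nat) (v y : 'I_n -> R) : seq (R * R) :=
  [seq (v i, y i) | i <- enum 'I_n].

Section Pairing.
Variable R : realType.
Implicit Types (g : R -> R) (s t : seq (R * R)).

Lemma big_meas n (v y : 'I_n -> R) (F : R * R -> R) :
  \sum_(p <- meas v y) F p = \sum_i F (v i, y i).
Proof. by rewrite big_map big_enum. Qed.

Lemma pairingC g s t : pairing g s t = pairing g t s.
Proof.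
rewrite /pairing exchange_big /=; apply: eq_bigr => q _; apply: eq_bigr => p _.
by rewrite distrC (mulrC p.1).
Qed.

Lemma pairing_catl g s1 s2 t :
  pairing g (s1 ++ s2) t = pairing g s1 t + pairing g s2 t.
Proof. by rewrite /pairing big_cat. Qed.

Lemma pairing_scalel g c s t : pairing g (scale_meas c s) t = c * pairing g s t.
Proof.
rewrite /pairing big_map big_distrr; apply: eq_bigr => p _.
by rewrite big_distrr; apply: eq_bigr => q _ /=; rewrite !mulrA.
Qed.

Lemma pairing_lincomb g c s t :
  pairing g (s ++ scale_meas c t) (s ++ scale_meas c t) =
  pairing g s s + 2 * c * pairing g s t + c ^+ 2 * pairing g t t.
Proof.
rewrite pairing_catl pairing_scalel ![pairing g _ (_ ++ _)]pairingC.
rewrite !pairing_catl !pairing_scalel (pairingC g t s); ring.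
Qed.

Lemma pairing_meas g n m (v y : 'I_n -> R) (w z : 'I_m -> R) :
  pairing g (meas v y) (meas w z) =
  \sum_i \sum_j v i * w j * g `|y i - z j|.
Proof. by rewrite /pairing big_meas; apply: eq_bigr => i _; rewrite big_meas. Qed.

Lemma moment_meas a n (v y : 'I_n -> R) :
  moment a (meas v y) = \sum_i v i * y i ^+ a.
Proof. by rewrite /moment big_meas. Qed.

Lemma vanishing_cat k s t :
  vanishing k s -> vanishing k t -> vanishing k (s ++ t).
Proof.
by move=> hs ht a ak; rewrite /moment big_cat /= -/(moment _ _) hs // -/(moment _ _) ht // addr0.
Qed.

Lemma vanishing_scale k c s : vanishing k s -> vanishing k (scale_meas c s).
Proof.
move=> hs a ak; rewrite /moment big_map /=.
under eq_bigr do rewrite -mulrA; by rewrite -big_distrr /= -/(moment _ _) hs // mulr0.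
Qed.

Lemma vanishingW j k s : (j <= k)%N -> vanishing k s -> vanishing j s.
Proof. by move=> jk hs a aj; apply: hs; apply: leq_trans jk. Qed.

Lemma pairing_even k s t :
  pairing (fun d => d ^+ k.*2) s t =
  \sum_(a < k.*2.+1) (-1) ^+ a * 'C(k.*2, a)%:R * moment (k.*2 - a) s * moment a t.
Proof.
transitivity (\sum_(p <- s) \sum_(q <- t) \sum_(a < k.*2.+1)
   (-1) ^+ a * 'C(k.*2, a)%:R * (p.1 * p.2 ^+ (k.*2 - a)) * (q.1 * q.2 ^+ a)).
  apply: eq_bigr => p _; apply: eq_bigr => q _.
  have -> : `|p.2 - q.2| ^+ k.*2 = (p.2 - q.2) ^+ k.*2.
    by rewrite -muln2 mulnC !exprM real_normK ?num_real.
  rewrite exprBn big_distrr /=.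
  apply: eq_bigr => a _; rewrite -mulr_natl; ring.
under eq_bigr do rewrite exchange_big /=.
rewrite exchange_big /=; apply: eq_bigr => a _.
rewrite -!mulrA !big_distrl big_distrr /= big_distrr /=; apply: eq_bigr => p _.
rewrite !big_distrr /=; apply: eq_bigr => q _; ring.
Qed.

Lemma pairing_even_eq0 i j k s t : vanishing i s -> vanishing j t ->
  (k.*2 < i + j)%N -> pairing (fun d => d ^+ k.*2) s t = 0.
Proof.
move=> hs ht kij; rewrite pairing_even big1 // => a _.
have [aj|ja] := ltnP a j; first by rewrite ht // mulr0.
by rewrite hs ?mulr0 ?mul0r //; have := ltn_ord a; lia.
Qed.

(** Only one term of the binomial expansion of (x - y)^(i + j) is left: the power
    of x must be at least i and that of y at least j. *)
Lemma pairing_even_lead i j k s t : vanishing i s -> vanishing j t ->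
  (k.*2 = i + j)%N -> pairing (fun d => d ^+ k.*2) s t =
  (-1) ^+ j * 'C(i + j, i)%:R * moment i s * moment j t.
Proof.
move=> hs ht kij; rewrite pairing_even.
have jk : (j < k.*2.+1)%N by lia.
rewrite (bigD1 (Ordinal jk)) //= big1 ?addr0; last first.
  move=> a /eqP aj; have {aj} : nat_of_ord a != j by apply/eqP => ?; apply: aj; apply: val_inj.
  rewrite neq_ltn => /orP[aj|ja]; first by rewrite ht // mulr0.
  by rewrite hs ?mulr0 ?mul0r //; have := ltn_ord a; lia.
by rewrite kij addnK -bin_sub ?leq_addl // addnK.
Qed.

(** Positive definiteness speaks of distinct points; merging equal atoms makes it
    apply to arbitrary measures. *)
Lemma merge_points s : exists n (y v : 'I_n -> R), injective y /\
  forall h : R -> R, \sum_(p <- s) p.1 * h p.2 = \sum_i v i * h (y i).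
Proof.
pose pts := undup [seq p.2 | p <- s].
pose y (i : 'I_(size pts)) := nth 0 pts i.
have y_inj : injective y.
  move=> i j /eqP; rewrite nth_uniq ?undup_uniq //; first by move/eqP/val_inj.
exists (size pts), y, (fun i => \sum_(p <- s | y i == p.2) p.1); split=> // h.
under [RHS]eq_bigr => i _ do rewrite big_distrl /= big_mkcond /=.
rewrite exchange_big /= big_seq [RHS]big_seq; apply: eq_bigr => p ps.
have p_in : p.2 \in pts by rewrite mem_undup; apply: map_f.
have ip : (index p.2 pts < size pts)%N by rewrite index_mem.
have yip : y (Ordinal ip) = p.2 by rewrite /y nth_index.
rewrite -big_mkcond (big_pred1 (Ordinal ip)) ?yip // => i /=.
by rewrite -(inj_eq y_inj) yip.
Qed.

Lemma pairing_psd kappa f s : pd_kernel kappa -> stationary kappa f ->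
  0 <= pairing f s s.
Proof.
move=> kpd kst; have [n [y [v [y_inj hv]]]] := merge_points s.
have -> : pairing f s s = \sum_i \sum_j v i * v j * f `|y i - y j|.
  rewrite /pairing.
  under eq_bigr => p _ do [under eq_bigr => q _ do rewrite -mulrA];
  under eq_bigr => p _ do rewrite -big_distrr /= (hv (fun z => f `|p.2 - z|)).
  rewrite (hv (fun x => \sum_i v i * f `|x - y i|)); apply: eq_bigr => i _.
  by rewrite big_distrr; apply: eq_bigr => j _ /=; rewrite mulrA.
have [v0|v0] := eqVneq (\col_i v i) 0.
  rewrite big1 // => i _; rewrite big1 // => j _.
  by have /matrixP/(_ i 0) := v0; rewrite !mxE => ->; rewrite !mul0r.
have [_ /(_ _ v0)] := kpd _ _ y_inj; move=> /ltW; congr (_ <= _).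
rewrite !mxE exchange_big /=; apply: eq_bigr => j _; rewrite !mxE big_distrl.
by apply: eq_bigr => i _; rewrite !mxE kst mulrAC.
Qed.

(** The Cauchy-Schwarz inequality for two vectors, from the nonnegativity of
    their pencil only; it serves for the kernel and for forms that are
    nonnegative on a subspace. *)
Lemma sqr_le_of_quadratic_ge0 (a b c : R) : 0 <= c ->
  (forall l, 0 <= a + 2 * l * b + l ^+ 2 * c) -> b ^+ 2 <= a * c.
Proof.
rewrite le_eqVlt => /predU1P[<-|c0] h.
  have [->|b0] := eqVneq b 0; first by rewrite expr0n mulr0.
  have := h (- (a + 1) / (2 * b)).
  have -> : a + 2 * (- (a + 1) / (2 * b)) * b + (- (a + 1) / (2 * b)) ^+ 2 * 0 = -1.
    by field.
  by rewrite ler0N1.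
have := h (- b / c).
have -> : a + 2 * (- b / c) * b + (- b / c) ^+ 2 * c = (a * c - b ^+ 2) / c.
  by field; rewrite gt_eqF.
by rewrite pmulr_lge0 ?invr_gt0 // subr_ge0.
Qed.

Lemma pairing_CauchySchwarz kappa f s t : pd_kernel kappa ->
  stationary kappa f -> pairing f s t ^+ 2 <= pairing f s s * pairing f t t.
Proof.
move=> kpd kst; have psd u := pairing_psd u kpd kst.
by apply: sqr_le_of_quadratic_ge0 => // l; rewrite -pairing_lincomb.
Qed.
End Pairing.

(** * Finite differences and B-splines *)

Definition fdiff (R : realType) (h : R) (g : R -> R) : R -> R :=
  fun t => g (t + h) - g t.

(** The n-th forward difference of step h at c as a measure; the recursion keeps
    repeated atoms and so needs no binomial coefficients. *)
Fixpoint diff_meas (R : realType) (n : nat) (h c : R) : seq (R * R) :=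
  if n is n'.+1 then
    diff_meas n' h (c + h) ++ scale_meas (-1) (diff_meas n' h c)
  else [:: (1, c)].

Section FiniteDifferences.
Variable R : realType.
Implicit Types (g : R -> R) (h c t : R).

Lemma iter_fdiffS n h g t : iter n.+1 (fdiff h) g t =
  iter n (fdiff h) g (t + h) - iter n (fdiff h) g t.
Proof. by []. Qed.

Lemma eq_iter_fdiff n h g1 g2 t :
  (forall i : nat, (i <= n)%N -> g1 (t + i%:R * h) = g2 (t + i%:R * h)) ->
  iter n (fdiff h) g1 t = iter n (fdiff h) g2 t.
Proof.
elim: n t => [|n IHn] t eg /=; first by have := eg 0%N isT; rewrite mul0r addr0.
rewrite /fdiff; congr (_ - _); apply: IHn => i ilen; last exact/eg/leqW.
by have := eg i.+1 ilen; rewrite -natr1 mulrDl mul1r -addrA (addrC h).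
Qed.

Lemma diff_measE n h c g :
  \sum_(p <- diff_meas n h c) p.1 * g p.2 = iter n (fdiff h) g c.
Proof.
elim: n c => [|n IHn] c /=; first by rewrite big_seq1 mul1r.
rewrite big_cat /= IHn /fdiff -IHn big_map; congr (_ + _).
by rewrite -IHn -sumrN; apply: eq_bigr => p _ /=; rewrite mulN1r mulNr.
Qed.

(** The Leibniz rule for the product with the identity; it drives both the
    annihilation of polynomials and the recursion of B-splines. *)
Lemma iter_fdiff_mulX n h g t :
  iter n (fdiff h) (fun x => x * g x) t =
  (t + n%:R * h) * iter n (fdiff h) g t + n%:R * h * iter n.-1 (fdiff h) g t.
Proof.
elim: n t => [|n IHn] t; first by rewrite !mul0r !addr0.
rewrite !iter_fdiffS !IHn [n.+1.-1]/= -natr1.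
case: n {IHn} => [|n] /=; first by ring.
by rewrite /fdiff; ring.
Qed.

Lemma iter_fdiff_exp n a h t : (a < n)%N -> iter n (fdiff h) (fun x => x ^+ a) t = 0.
Proof.
elim: a n t => [|a IHa] [//|n] t an.
  rewrite iterSr (@eq_iter_fdiff _ _ _ (fun=> 0)) => [|i _]; last by rewrite /fdiff subrr.
  by elim: n {an} t => //= n IHn t; rewrite /fdiff !IHn subrr.
rewrite (@eq_iter_fdiff _ _ _ (fun x => x * x ^+ a)) => [|i _]; last exact: exprS.
by rewrite iter_fdiff_mulX !IHa ?mulr0 ?addr0 //; lia.
Qed.

Lemma iter_fdiff_shift n h g c t :
  iter n (fdiff h) (fun x => g (x + c)) t = iter n (fdiff h) g (t + c).
Proof. by elim: n t => //= n IHn t; rewrite /fdiff !IHn addrAC. Qed.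

Lemma iter_fdiff_reflect n h g c t :
  iter n (fdiff h) (fun x => g (c - x)) t =
  (-1) ^+ n * iter n (fdiff h) g (c - t - n%:R * h).
Proof.
elim: n t => [|n IHn] t; first by rewrite /= mul0r subr0 expr0 mul1r.
rewrite !iter_fdiffS !IHn -natr1 exprS.
have -> : c - (t + h) - n%:R * h = c - t - (n%:R + 1) * h by ring.
have -> : c - t - n%:R * h = c - t - (n%:R + 1) * h + h by ring.
ring.
Qed.

Lemma iter_fdiff_scale n h g a t :
  iter n (fdiff h) (fun x => a * g x) t = a * iter n (fdiff h) g t.
Proof. by elim: n t => //= n IHn t; rewrite /fdiff !IHn mulrBr. Qed.

Lemma iter_fdiffB n h g1 g2 t :
  iter n (fdiff h) (fun x => g1 x - g2 x) t =
  iter n (fdiff h) g1 t - iter n (fdiff h) g2 t.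
Proof. by elim: n t => //= n IHn t; rewrite /fdiff !IHn; ring. Qed.

Lemma iter_fdiff_dilate n h g t :
  iter n (fdiff 1) (fun x => g (h * x)) t = iter n (fdiff h) g (h * t).
Proof. by elim: n t => //= n IHn t; rewrite /fdiff !IHn mulrDr mulr1. Qed.

Lemma sum_diff_meas_dist g n h c a :
  \sum_(q <- diff_meas n h c) q.1 * g `|a - q.2| =
  iter n (fdiff h) (fun y => g `|y - a|) c.
Proof. by rewrite -diff_measE; apply: eq_bigr => q _; rewrite distrC. Qed.

Lemma vanishing_diff_meas n h c : vanishing n (diff_meas n h c).
Proof. by move=> a an; rewrite /moment (diff_measE _ _ _ (fun x => x ^+ a)) iter_fdiff_exp. Qed.

(** This is n! times the cardinal B-spline of degree n, supported in [-(n+1), 0]. *)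
Definition bspline n t : R := iter n.+1 (fdiff 1) (fun x => Num.max x 0 ^+ n) t.

Lemma bspline_rec n t : (0 < n)%N ->
  bspline n.+1 t = (t + n.+2%:R) * bspline n (t + 1) - t * bspline n t.
Proof.
move=> n_gt0; rewrite /bspline.
rewrite (@eq_iter_fdiff _ _ _ (fun x => x * Num.max x 0 ^+ n)) => [|i _].
  rewrite iter_fdiff_mulX [n.+2.-1]/= iter_fdiffS.
  ring.
rewrite exprS; set x := t + _; case: (leP x 0) => x0 //.
by rewrite mul0r expr0n gtn_eqF // mulr0.
Qed.

(** By the recursion, inside the support the spline is a combination with positive
    coefficients of two values of the spline of lower degree, which are
    nonnegative and not both zero. *)
Lemma bspline_sign n t : (0 < n)%N ->
  (0 <= t \/ t <= - n.+1%:R -> bspline n t = 0) /\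
  (- n.+1%:R < t < 0 -> 0 < bspline n t).
Proof.
elim: n t => // -[_|n IHn] t _.
  rewrite /bspline /= /fdiff !expr1 /Num.max.
  by split=> [[?|?]|/andP[? ?]]; 
    case: (ltP (t + 1 + 1) 0) => ?; case: (ltP (t + 1) 0) => ?; case: (ltP t 0) => ?; lra.
have [IH1 IH1p] := IHn (t + 1) isT.
have [IH0 IH0p] := IHn t isT.
rewrite bspline_rec // -[n.+3%:R]natr1 -[n.+2%:R]natr1.
rewrite -[n.+2%:R]natr1 in IH1 IH1p IH0 IH0p *.
have n0 : 0 <= n.+1%:R :> R by [].
set N := n.+1%:R in n0 IH1 IH1p IH0 IH0p *.
have ge0 (s : R) : (0 <= s \/ s <= - (N + 1) -> bspline n.+1 s = 0) ->
    (- (N + 1) < s < 0 -> 0 < bspline n.+1 s) -> 0 <= bspline n.+1 s.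
  move=> z p; have [s0|s0] := leP 0 s; first by rewrite z //; left.
  have [s1|s1] := leP s (- (N + 1)); first by rewrite z //; right.
  by rewrite ltW // p // s0 s1.
have {ge0}[g1 g0] := (ge0 _ IH1 IH1p, ge0 _ IH0 IH0p).
split=> [tt|/andP[t1 t2]].
  case: tt => tt; first by rewrite IH1 ?IH0; [lra|left|left; lra].
  by rewrite IH1 ?IH0; [lra|right; lra|right; lra].
have [tN|tN] := ltP (- (N + 1)) t.
  apply: (@lt_le_trans _ _ (- t * bspline n.+1 t)); last by nra.
  by rewrite mulr_gt0 ?oppr_gt0 // IH0p // tN t2.
have N1 : 1 <= N by rewrite ler1n.
apply: (@lt_le_trans _ _ ((t + (N + 1 + 1)) * bspline n.+1 (t + 1))).
  by rewrite mulr_gt0 //; [lra|apply: IH1p; lra].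
by nra.
Qed.

(** Since 2r - 1 is odd, |x|^(2r-1) = 2 max(x, 0)^(2r-1) - x^(2r-1), and the 2r-th
    difference kills the polynomial: what is left is twice the central value of
    a B-spline. *)
Lemma central_diff_abs_gt0 r : (0 < r)%N ->
  0 < iter (2 * r) (fdiff 1) (fun x => `|x| ^+ (2 * r - 1)) (- r%:R : R).
Proof.
move=> r_gt0; pose N := (2 * r - 1)%N.
have rN : (2 * r = N.+1)%N by rewrite /N; lia.
rewrite -/N rN (@eq_iter_fdiff _ _ _
  (fun x => 2 * Num.max x 0 ^+ N - x ^+ N)); last first.
  move=> i _; set x := - _ + _; have [x0|x0] := leP 0 x.
    by rewrite ger0_norm //; ring.
  have Nodd : odd N by have := congr1 odd rN; rewrite oddM /=; case: odd.
  have N0 : (N == 0%N) = false by case: (N) Nodd.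
  by rewrite ltr0_norm // expr0n N0 mulr0 add0r exprNn -signr_odd Nodd mulN1r.
rewrite iter_fdiffB iter_fdiff_exp // subr0 iter_fdiff_scale mulr_gt0 //.
apply: (bspline_sign _ _).2; first by rewrite /N; lia.
by rewrite ltrN2 oppr_lt0 ltr_nat ltr0n r_gt0 andbT /N; lia.
Qed.
End FiniteDifferences.

(** * Taylor expansion at the origin *)

Section Taylor.
Variable R : realType.

Lemma sum_geometric_tail (q : R) m j : 0 <= q <= 2^-1 ->
  \sum_(m <= k < m + j) q ^+ k <= 2 * q ^+ m.
Proof.
move=> /andP[q0 q1]; elim: j m => [|j IHj] m.
  by rewrite addn0 big_geq // mulr_ge0 ?exprn_ge0.
rewrite big_ltn ?addnS ?ltnS ?leq_addr // -addSn.
have := IHj m.+1; have := exprn_ge0 m q0; rewrite exprS => qm h.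
by nra.
Qed.

Definition taylor_poly (f : R -> R) (K : nat) : {poly R} :=
  \poly_(k < K) taylor_coef f k.

(** The terms of a convergent power series at t0 > 0 are bounded, so that on
    [0, t0 / 2] the tail is dominated by a geometric series of ratio 1/2. *)
Lemma taylor_poly_remainder f K : analytic_at0 f -> exists C d : R,
  [/\ 0 <= C, 0 < d & forall t, 0 <= t <= d ->
    `|f t - (taylor_poly f K).[t]| <= C * t ^+ K].
Proof.
set c := taylor_coef f => /nbhs_ballP[e /= e_gt0 he].
have fcvg t : 0 <= t < e -> pseries c t @ \oo --> f t.
  by move=> /andP[t0 te]; apply: he; rewrite /ball /= sub0r normrN ger0_norm.
pose t0 := e / 2; have t0_gt0 : 0 < t0 by rewrite divr_gt0.
have t0e : t0 < e by rewrite /t0; lra.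
have /cvgP/cvg_series_bounded : series (fun i => c i * t0 ^+ i) @ \oo --> f t0.
  by apply: fcvg; rewrite ltW.
move=> /ex_strict_bound_gt0[M M_gt0 hM].
exists (2 * M / t0 ^+ K), (t0 / 2); split; first by rewrite divr_ge0 ?mulr_ge0 ?exprn_ge0 ?ltW.
  by rewrite divr_gt0.
move=> t /andP[t_ge0 tt0].
have te : t < e by lra.
have q01 : 0 <= t / t0 <= 2^-1.
  by rewrite divr_ge0 ?(ltW t0_gt0) //= ler_pdivrMr //; lra.
have tcvg := fcvg t (introT andP (conj t_ge0 te)).
rewrite horner_poly.
set P := \sum_(i < K) _.
have rem_cvg : `|pseries c t n - P| @[n --> \oo] --> `|f t - P|.
  by apply: cvg_norm; apply: cvgB => //; exact: cvg_cst.
apply: (cvgr_to_le rem_cvg); near=> n.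
have Kn : (K <= n)%N by near: n; exact: nbhs_infty_ge.
rewrite /pseries /series /= /P -(big_mkord xpredT (fun i => c i * t ^+ i)).
rewrite (@big_cat_nat _ _ _ K 0 n) //= addrAC subrr add0r.
apply: (le_trans (ler_norm_sum _ _ _)).
have -> : 2 * M / t0 ^+ K * t ^+ K = M * (2 * (t / t0) ^+ K).
  by rewrite (expr_div_n t t0) !mulrA (mulrC M) mulrAC.
apply: (@le_trans _ _ (\sum_(K <= i < n) M * (t / t0) ^+ i)).
  apply: ler_sum => i _.
  have -> : c i * t ^+ i = c i * t0 ^+ i * (t / t0) ^+ i.
    by rewrite (expr_div_n t t0) -mulrA (mulrC (t0 ^+ i)) divfK // expf_neq0 // gt_eqF.
  rewrite normrM (ger0_norm (exprn_ge0 _ _)); last by case/andP: q01.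
  apply: ler_wpM2r; first by rewrite exprn_ge0 //; case/andP: q01.
  exact/ltW/(hM i).
by rewrite -big_distrr /= ler_pM2l // -(subnKC Kn) sum_geometric_tail.
Unshelve. all: by end_near. Qed.

Lemma cvg_at_right0_poly (p : {poly R}) : p.[e] @[e --> (0 : R)^'+] --> p.[0].
Proof. apply: cvg_at_right_filter; exact: continuous_horner. Qed.

Lemma taylor_expansion_cvg f p d : analytic_at0 f -> 0 <= d ->
  e ^- p * (f (e * d) - \sum_(k < p) taylor_coef f k * (e * d) ^+ k) @[e --> (0 : R)^'+]
   --> taylor_coef f p * d ^+ p.
Proof.
move=> fan d_ge0; have [C [t0 [C_ge0 t0_gt0 hC]]] := taylor_poly_remainder p.+1 fan.
set l := _ * d ^+ p; set c := taylor_coef f.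
have bnd_cvg (b : R) : l + b * e @[e --> (0 : R)^'+] --> l.
  have := @cvg_at_right0_poly (l%:P + b *: 'X); rewrite !hornerE ?mulr0 ?addr0.
  by under eq_fun do rewrite !hornerE.
apply: (squeeze_cvgr _ (bnd_cvg (- (C * d ^+ p.+1))) (bnd_cvg (C * d ^+ p.+1))).
near=> e; have e_gt0 : 0 < e by [].
have edt : e * d <= t0.
  near: e.
  have [->|d0] := eqVneq d 0; first by near=> e; rewrite mulr0 ltW.
  have dp : 0 < d by rewrite lt0r d0.
  near=> e; rewrite -ler_pdivlMr //; near: e; apply: nbhs_right_le; exact: divr_gt0.
have ed0 : 0 <= e * d by rewrite mulr_ge0 // ltW.
have := hC (e * d) (introT andP (conj ed0 edt)).
rewrite horner_poly big_ord_recr /= -/c => h.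
rewrite mulNr -ler_distl.
have -> : e ^- p * (f (e * d) - \sum_(k < p) c k * (e * d) ^+ k) - l =
  e ^- p * (f (e * d) - (\sum_(i < p) c i * (e * d) ^+ i + c p * (e * d) ^+ p)).
  rewrite opprD addrA [in RHS]mulrDr /l -/c mulrN; congr (_ - _).
  by rewrite exprMn mulrCA mulKf // expf_neq0 // gt_eqF.
rewrite normrM ger0_norm; last by rewrite invr_ge0 exprn_ge0 // ltW.
rewrite ler_pdivrMl ?exprn_gt0 //; apply: le_trans h _.
by rewrite exprMn (exprS e) le_eqVlt; apply/orP; left; apply/eqP; ring.
Unshelve. all: by end_near. Qed.
End Taylor.

(** * Flat limit of pairings *)

Definition dilate_meas (R : realType) (e : R) (s : seq (R * R)) :=
  [seq (p.1, e * p.2) | p <- s].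

Section Flat.
Variable R : realType.
Implicit Types (f : R -> R) (s t : seq (R * R)).

Lemma cvg_sum_list (T I : Type) (F : set_system T) (FF : Filter F) (s : seq I)
    (g : I -> T -> R) (l : I -> R) :
  (forall i, g i x @[x --> F] --> l i) ->
  \sum_(i <- s) g i x @[x --> F] --> \sum_(i <- s) l i.
Proof. by move=> gl; apply: cvg_big => //; exact: add_continuous. Qed.

Lemma pairing_dilate f e s t : 0 <= e ->
  pairing f (dilate_meas e s) (dilate_meas e t) = pairing (fun d => f (e * d)) s t.
Proof.
move=> e0; rewrite /pairing big_map; apply: eq_bigr => p _.
rewrite big_map; apply: eq_bigr => q _ /=.
by rewrite -mulrBr normrM (ger0_norm e0).
Qed.

Lemma pairing_expansion_cvg f p s t : analytic_at0 f ->
  e ^- p * (pairing (fun d => f (e * d)) s t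
            - \sum_(k < p) taylor_coef f k * e ^+ k * pairing (fun d => d ^+ k) s t)
    @[e --> (0 : R)^'+] --> taylor_coef f p * pairing (fun d => d ^+ p) s t.
Proof.
move=> fan; set c := taylor_coef f.
have -> : (fun e => e ^- p * (pairing (fun d => f (e * d)) s t
    - \sum_(k < p) c k * e ^+ k * pairing (fun d => d ^+ k) s t)) =
  (fun e => \sum_(a <- s) \sum_(b <- t) a.1 * b.1 * (e ^- p *
    (f (e * `|a.2 - b.2|) - \sum_(k < p) c k * (e * `|a.2 - b.2|) ^+ k))).
  apply/funext => e; rewrite /pairing.
  under [X in _ - X]eq_bigr => k _ do rewrite big_distrr /=.
  rewrite [X in _ - X]exchange_big -sumrB big_distrr /=; apply: eq_bigr => a _.
  under [X in _ - X]eq_bigr => k _ do rewrite big_distrr /=.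
  rewrite [X in _ - X]exchange_big -sumrB big_distrr /=; apply: eq_bigr => b _.
  rewrite [RHS]mulrCA [in RHS]mulrBr; congr (_ * (_ - _)).
  by rewrite big_distrr; apply: eq_bigr => k _ /=; rewrite exprMn; ring.
rewrite big_distrr /=; apply: cvg_sum_list => a.
rewrite big_distrr /=; apply: cvg_sum_list => b.
rewrite mulrCA; apply: cvgM; first exact: cvg_cst.
by apply: taylor_expansion_cvg => //.
Qed.

Section Order.
Variables (f : R -> R) (r : nat).
Hypotheses (f_analytic : analytic_at0 f) (f_order : smoothness_order f r).

Lemma smoothness_gt0 : (0 < r)%N. Proof. by case: f_order. Qed.

Lemma odd_coef_eq0 k : odd k -> (k < 2 * r - 1)%N -> taylor_coef f k = 0.
Proof.
case: f_order => _ _ h kodd kr.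
have kE : k = (2 * k.+1./2 - 1)%N by have := odd_double_half k; rewrite kodd; lia.
by rewrite kE h //; have := odd_double_half k; rewrite kodd; lia.
Qed.

(** Odd k: the coefficient vanishes, by definition of the smoothness order. Even
    k: the pairing vanishes, because |x - y|^k is a polynomial. *)
Lemma pairing_lower_eq0 i j k s t : vanishing i s -> vanishing j t ->
  (k < i + j)%N -> (k < 2 * r - 1)%N ->
  taylor_coef f k * pairing (fun d => d ^+ k) s t = 0.
Proof.
move=> hs ht kij kr; have [kodd|keven] := boolP (odd k).
  by rewrite odd_coef_eq0 // mul0r.
have kE : k = k./2.*2 by rewrite -[LHS]odd_double_half (negbTE keven).
by rewrite kE (pairing_even_eq0 hs ht) ?mulr0 // -kE.
Qed.

Lemma pairing_order_cvg i j p s t : vanishing i s -> vanishing j t ->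
  (p <= i + j)%N -> (p <= 2 * r - 1)%N ->
  e ^- p * pairing (fun d => f (e * d)) s t @[e --> (0 : R)^'+] -->
    taylor_coef f p * pairing (fun d => d ^+ p) s t.
Proof.
move=> hs ht pij pr; have := @pairing_expansion_cvg _ p s t f_analytic.
have low e : \sum_(k < p) taylor_coef f k * e ^+ k * pairing (fun d => d ^+ k) s t = 0.
  apply: big1 => k _; rewrite mulrAC (pairing_lower_eq0 hs ht) ?mul0r //.
    exact: leq_trans (ltn_ord k) pij.
  exact: leq_trans (ltn_ord k) pr.
by under eq_fun => e do rewrite low subr0.
Qed.

Variable kappa : R -> R -> R.
Hypotheses (kappa_pd : pd_kernel kappa) (kappa_stat : stationary kappa f).

Let D := fun d : R => d ^+ (2 * r - 1).

(** The right-hand side is the limit of e^(1 - 2r) times the squared norm of s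
    dilated by e, since 2r - 1 < r + r. *)
Lemma coef_pairing_ge0 s : vanishing r s ->
  0 <= taylor_coef f (2 * r - 1) * pairing D s s.
Proof.
move=> hs; have hlim := @pairing_order_cvg r r (2 * r - 1) s s hs hs.
apply: (cvgr_to_ge (hlim _ _)) => //; first by lia.
near=> e; have e_gt0 : 0 < e by [].
rewrite mulr_ge0 ?invr_ge0 ?exprn_ge0 ?(ltW e_gt0) //.
rewrite -pairing_dilate ?(ltW e_gt0) //; exact: pairing_psd kappa_pd kappa_stat.
Unshelve. all: by end_near. Qed.

(** An r-th difference paired with itself is a 2r-th difference of the profile;
    the reflection y -> -y in the second argument contributes the sign. *)
Lemma pairing_diff_meas_self :
  pairing D (diff_meas r 1 0) (diff_meas r 1 0) =
  (-1) ^+ r * iter (2 * r) (fdiff 1) (fun x => `|x| ^+ (2 * r - 1)) (- r%:R).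
Proof.
rewrite /pairing.
under eq_bigr => p _ do [under eq_bigr => q _ do rewrite -mulrA];
under eq_bigr => p _ do rewrite -big_distrr /= sum_diff_meas_dist.
rewrite (diff_measE _ _ _ (fun a => iter r (fdiff 1) (fun y => D `|y - a|) 0)).
set G := fun x : R => `|x| ^+ (2 * r - 1).
transitivity (iter r (fdiff 1) (fun a => (-1) ^+ r * iter r (fdiff 1) G (a - r%:R)) 0).
  apply: eq_iter_fdiff => i _; set a := 0 + _.
  have := iter_fdiff_reflect r 1 G a 0; rewrite subr0 mulr1 => <-.
  by apply: eq_iter_fdiff => j _; rewrite /G distrC.
by rewrite iter_fdiff_scale iter_fdiff_shift add0r mul2n -addnn iterD.
Qed.

Lemma signed_coef_gt0 : 0 < (-1) ^+ r * taylor_coef f (2 * r - 1).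
Proof.
have S_gt0 := central_diff_abs_gt0 R smoothness_gt0.
have := coef_pairing_ge0 (vanishing_diff_meas 1 0).
rewrite pairing_diff_meas_self mulrA (mulrC _ (_ ^+ _)) pmulr_lge0 //.
rewrite le_eqVlt => /predU1P[/esym/eqP|//].
by case: f_order => _ /negbTE c0 _; rewrite mulf_eq0 signr_eq0 c0.
Qed.

Lemma cond_psd s : vanishing r s -> 0 <= (-1) ^+ r * pairing D s s.
Proof.
move=> hs; rewrite -(pmulr_rge0 _ signed_coef_gt0) mulrACA -expr2 sqrr_sign mul1r.
exact: coef_pairing_ge0.
Qed.

(** Were the form degenerate at v, Cauchy-Schwarz would make v orthogonal to every
    2r-th difference u. Centre u at an atom y i0, with a small step: the other
    atoms see a polynomial of degree 2r - 1, killed by u, and the atom itself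
    contributes v i0 times the positive central difference of |.|^(2r-1). *)
Lemma cond_definite n (v y : 'I_n -> R) : injective y ->
  vanishing r (meas v y) -> pairing D (meas v y) (meas v y) = 0 ->
  forall i, v i = 0.
Proof.
move=> y_inj hv v0 i0.
(* The step h is chosen so that [y i0 - r h, y i0 + r h] contains no y i with
   i != i0 in its interior: seen from there, |y i - .| is affine. *)
have [h h_gt0 hh] : exists2 h : R, 0 < h & forall i, i != i0 -> r%:R * h <= `|y i - y i0|.
  pose m := \big[Order.min/1]_(i | i != i0) `|y i - y i0|.
  have m_gt0 : 0 < m.
    apply: (@big_ind _ (fun x : R => 0 < x)) => // [a b a0 b0|i ii0].
      by rewrite lt_min a0.
    by rewrite normr_gt0 subr_eq0 (inj_eq y_inj).
  exists (m / r%:R); first by rewrite divr_gt0 // ltr0n smoothness_gt0.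
  move=> i ii0; rewrite mulrC divfK ?pnatr_eq0 -?lt0n ?smoothness_gt0 //.
  by rewrite /m (bigD1 i) //= ge_min lexx.
pose u := diff_meas (2 * r) h (y i0 - r%:R * h).
have hu : vanishing r u by apply: vanishingW (vanishing_diff_meas _ _); lia.
have : ((-1) ^+ r * pairing D (meas v y) u) ^+ 2 <= 0 * ((-1) ^+ r * pairing D u u).
  apply: sqr_le_of_quadratic_ge0 => [|l]; first exact: cond_psd.
  have := cond_psd (vanishing_cat hv (vanishing_scale l hu)).
  rewrite pairing_lincomb v0; congr (_ <= _); ring.
rewrite mul0r exprMn sqrr_sign mul1r => Dvu_le0.
have {Dvu_le0} : pairing D (meas v y) u = 0.
  by apply/eqP; rewrite -sqrf_eq0 eq_le Dvu_le0 sqr_ge0.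
rewrite /pairing big_meas (bigD1 i0) //= [X in _ + X]big1 ?addr0 => [|i ii0].
  under eq_bigr => q _ do rewrite -mulrA; rewrite -big_distrr /= sum_diff_meas_dist.
  rewrite (iter_fdiff_shift _ _ (fun x => D `|x|)) addrAC subrr add0r.
  have -> : - (r%:R * h) = h * - r%:R by ring.
  rewrite -iter_fdiff_dilate.
  rewrite (@eq_iter_fdiff _ _ _ _ (fun x => h ^+ (2 * r - 1) * `|x| ^+ (2 * r - 1))).
    rewrite iter_fdiff_scale => /eqP; rewrite !mulf_eq0 expf_eq0 (gt_eqF h_gt0) andbF /=.
    by rewrite (gt_eqF (central_diff_abs_gt0 R smoothness_gt0)) !orbF => /eqP.
  by move=> j _; rewrite /D normrM (ger0_norm (ltW h_gt0)) exprMn.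
under eq_bigr => q _ do rewrite -mulrA; rewrite -big_distrr /= sum_diff_meas_dist.
rewrite (@eq_iter_fdiff _ _ _ _ (fun x => Num.sg (y i0 - y i) ^+ (2 * r - 1) *
   (x - y i) ^+ (2 * r - 1))).
  rewrite iter_fdiff_scale (iter_fdiff_shift _ _ (fun x => x ^+ _)).
  by rewrite iter_fdiff_exp ?mulr0 //; have := smoothness_gt0; lia.
move=> j jr; rewrite /D -exprMn; congr (_ ^+ _).
have := hh i ii0; have jr' : j%:R <= 2 * r%:R :> R by rewrite -natrM ler_nat.
have j0 : 0 <= j%:R :> R by [].
have jh : 0 <= j%:R * h <= 2 * (r%:R * h).
  by rewrite mulr_ge0 ?(ltW h_gt0) //= mulrA ler_pM2r.
case/andP: jh; set a := j%:R * h; set b := r%:R * h => a0 ab.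
have [ii|ii|ii] := ltgtP (y i) (y i0).
- by rewrite gtr0_sg ?subr_gt0 // mul1r => hb; rewrite distrC ger0_norm ?subr_ge0 ?(ltW ii) // in hb; rewrite ger0_norm //; lra.
- by rewrite ltr0_sg ?subr_lt0 // mulN1r => hb; rewrite ger0_norm ?subr_ge0 ?(ltW ii) // in hb; rewrite ler0_norm //; lra.
by move/y_inj: ii => /eqP; rewrite (negbTE ii0).
Qed.
End Order.
End Flat.

(** * Measures dual to the monomials *)

Section DualBasis.
Variable R : realType.

Lemma dual_basis n (y : 'I_n -> R) : injective y -> exists U : 'M[R]_n,
  U *m (Vandermonde n (\row_i y i))^T = 1%:M.
Proof.
move=> y_inj; exists (invmx (Vandermonde n (\row_i y i))^T).
apply: mulVmx; rewrite unitmx_tr unitmxE det_Vandermonde unitfE.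
apply/prodf_neq0 => i _; apply/prodf_neq0 => j ij; rewrite !mxE subr_eq0.
by rewrite (inj_eq y_inj) eq_sym neq_ltn ij.
Qed.

Lemma moment_dual n (y : 'I_n -> R) (U : 'M[R]_n) (i : 'I_n) b :
  U *m (Vandermonde n (\row_i y i))^T = 1%:M -> (b < n)%N ->
  moment b (meas (U i) y) = (nat_of_ord i == b)%:R.
Proof.
move=> /matrixP UV bn; have := UV i (Ordinal bn); rewrite !mxE -val_eqE /= => <-.
by rewrite moment_meas; apply: eq_bigr => k _; rewrite !mxE.
Qed.

Lemma vanishing_dual n (y : 'I_n -> R) (U : 'M[R]_n) (i : 'I_n) :
  U *m (Vandermonde n (\row_i y i))^T = 1%:M -> vanishing i (meas (U i) y).
Proof.
move=> U_dual b bi; rewrite (moment_dual _ U_dual); last exact: ltn_trans (ltn_ord i).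
by rewrite gtn_eqF.
Qed.

Lemma moment_dual_self n (y : 'I_n -> R) (U : 'M[R]_n) (i : 'I_n) :
  U *m (Vandermonde n (\row_i y i))^T = 1%:M -> moment i (meas (U i) y) = 1.
Proof. by move=> U_dual; rewrite (moment_dual _ U_dual) // eqxx. Qed.

Definition row_comb n (c : 'I_n -> R) (U : 'M[R]_n) : 'I_n -> R :=
  fun k => \sum_i c i * U i k.

Lemma sum_row_comb n (c : 'I_n -> R) (U : 'M[R]_n) (g : 'I_n -> R) :
  \sum_k row_comb c U k * g k = \sum_i c i * \sum_k U i k * g k.
Proof.
rewrite /row_comb; under eq_bigr => k _ do rewrite big_distrl /=.
rewrite exchange_big; apply: eq_bigr => i _; rewrite big_distrr.
by apply: eq_bigr => k _ /=; rewrite mulrA.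
Qed.

Lemma pairing_row_comb n g (c y : 'I_n -> R) (U : 'M[R]_n) :
  pairing g (meas (row_comb c U) y) (meas (row_comb c U) y) =
  \sum_i \sum_j c i * c j * pairing g (meas (U i) y) (meas (U j) y).
Proof.
rewrite pairing_meas.
under eq_bigr => k _.
  under eq_bigr => l _ do rewrite -mulrA.
  rewrite -big_distrr (sum_row_comb c U (fun l => g `|y k - y l|)) /=.
  over.
rewrite (sum_row_comb c U (fun k => \sum_j c j * \sum_l U j l * g `|y k - y l|)).
apply: eq_bigr => i _.
under eq_bigr => k _ do rewrite big_distrr /=.
rewrite exchange_big big_distrr; apply: eq_bigr => j _ /=.
rewrite pairing_meas -mulrA !big_distrr; apply: eq_bigr => k _ /=.
rewrite !big_distrr; apply: eq_bigr => l _ /=; ring.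
Qed.
End DualBasis.

(** * Nondegeneracy of the Wronskian matrix *)

Section AtRight.
Variable R : realType.

Lemma cvg_exp_at_right0 n : (0 < n)%N ->
  e ^+ n @[e --> (0 : R)^'+] --> (0 : R)^'+.
Proof.
move=> n_gt0 P hP.
have := @cvg_at_right0_poly R 'X^n; rewrite hornerXn expr0n gtn_eqF //.
under eq_fun do rewrite hornerXn.
move=> /(_ (fun u => 0 < u -> P u) hP) h.
suff : \forall e \near (0 : R)^'+, P (e ^+ n) by [].
near=> e; have eP : 0 < e ^+ n -> P (e ^+ n) by near: e; exact: h.
by apply: eP; rewrite exprn_gt0.
Unshelve. all: by end_near. Qed.

(** Peel off the constant coefficient, which is the limit at 0, and divide by t. *)
Lemma small_poly_coef_eq0 n (p : {poly R}) :
  p.[t] / t ^+ n @[t --> (0 : R)^'+] --> (0 : R) ->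
  forall l, (l <= n)%N -> p`_l = 0.
Proof.
elim: n p => [|n IHn] p hp;
  have p_cvg := @cvg_at_right0_poly R p : p.[t] @[t --> (0 : R)^'+] --> p.[0].
  move=> l; rewrite leqn0 => /eqP ->; rewrite -horner_coef0.
  move: hp; under eq_fun do rewrite expr0 divr1.
  by move=> hp; exact: (cvg_unique (@Rhausdorff R) p_cvg hp).
have p0 : p`_0 = 0.
  rewrite -horner_coef0; apply: (cvg_unique (@Rhausdorff R) p_cvg).
  have : p.[t] / t ^+ n.+1 * ('X^(n.+1)).[t] @[t --> (0 : R)^'+] --> (0 * ('X^(n.+1)).[0] : R).
    by apply: cvgM => //; exact: cvg_at_right0_poly.
  rewrite mul0r.
  apply: cvg_trans; apply: near_eq_cvg; near=> t.
  by rewrite /= hornerXn divfK // expf_neq0 // gt_eqF.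
have pE : p = drop_poly 1 p * 'X.
  rewrite -[LHS](poly_take_drop 1) expr1 -[RHS]add0r; congr (_ + _).
  by apply/polyP => -[|i]; rewrite coef_take_poly coef0.
case=> // l ln; rewrite -addn1 -coef_drop_poly; apply: IHn (ln).
move: hp; apply: cvg_trans; apply: near_eq_cvg; near=> t.
have -> : p.[t] = (drop_poly 1 p).[t] * t by rewrite [in LHS]pE hornerM hornerX.
by rewrite exprSr -mulf_div divff ?mulr1 // gt_eqF.
Unshelve. all: by end_near. Qed.
End AtRight.

Section Wronskian.
Variable R : realType.
Variables (f : R -> R) (r : nat).
Hypotheses (f_analytic : analytic_at0 f) (f_order : smoothness_order f r).
Variable kappa : R -> R -> R.
Hypotheses (kappa_pd : pd_kernel kappa) (kappa_stat : stationary kappa f).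
Let c := taylor_coef f.

(** The entry (i, j) is the coefficient of x^i y^j in the smooth part of
    f(|x - y|). *)
Definition wronskian_mx : 'M[R]_r :=
  \matrix_(i, j) ((-1) ^+ j * 'C(i + j, i)%:R * c (i + j)).
Let W := wronskian_mx.

Lemma wronskian_odd_eq0 (i j : 'I_r) : odd (i + j) -> W i j = 0.
Proof.
move=> ij; rewrite mxE /c (odd_coef_eq0 f_order) ?mulr0 //.
by have := ltn_ord i; have := ltn_ord j; lia.
Qed.

Lemma wronskianE (i j : 'I_r) s t : vanishing i s -> vanishing j t ->
  moment i s = 1 -> moment j t = 1 ->
  c (i + j) * pairing (fun d => d ^+ (i + j)) s t = W i j.
Proof.
move=> hs ht ms mt; have [ij|ij] := boolP (odd (i + j)).
  rewrite wronskian_odd_eq0 // /c (odd_coef_eq0 f_order) ?mul0r //.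
  by have := ltn_ord i; have := ltn_ord j; lia.
have kE : (i + j = (i + j)./2.*2)%N by rewrite -[LHS]odd_double_half (negbTE ij).
rewrite {2}kE (pairing_even_lead hs ht) -?kE // ms mt !mulr1 mxE; ring.
Qed.

(** The term of order i + j of the expansion is W i j, and all lower ones vanish.
    The
    rate O(e), and not the limit alone, allows two scales to be coupled when W
    is singular. *)
Lemma wronskian_next_cvg (i j : 'I_r) s t : vanishing i s -> vanishing j t ->
  moment i s = 1 -> moment j t = 1 ->
  (e ^- (i + j) * pairing (fun d => f (e * d)) s t - W i j) / e @[e --> (0 : R)^'+]
    --> c (i + j).+1 * pairing (fun d => d ^+ (i + j).+1) s t.
Proof.
move=> hs ht ms mt.
have := @pairing_expansion_cvg _ _ (i + j).+1 s t f_analytic; apply: cvg_trans.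
apply: near_eq_cvg; near=> e.
have e_neq0 : e != 0 by rewrite gt_eqF.
rewrite big_ord_recr /= big1 ?add0r => [|k _]; last first.
  rewrite mulrAC (pairing_lower_eq0 f_order hs ht) ?mul0r //.
  by have := ltn_ord i; have := ltn_ord j; have := ltn_ord k; lia.
rewrite mulrAC -/c (wronskianE hs ht ms mt) exprSr invfM.
have := expf_neq0 (i + j) e_neq0; set E := e ^+ _ => E_neq0.
by field; rewrite e_neq0 E_neq0.
Unshelve. all: by end_near. Qed.

Section NullCombination.
Variables (y : 'I_r -> R) (U : 'M[R]_r) (a : 'I_r -> R).
Hypothesis y_ge0 : forall k, 0 <= y k.
Hypothesis U_dual : U *m (Vandermonde r (\row_i y i))^T = 1%:M.
Hypothesis a_null : \sum_i \sum_j a i * a j * W i j = 0.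

Let u e := row_comb (fun i => a i * e ^- i) U.

(** Along a null vector a of W the leading term of the squared norm of the measure
    representing sum_i a_i f^(i)/i! at scale e cancels, leaving O(e). *)
Lemma null_norm_cvg : exists l : R,
  pairing (fun d => f (e * d)) (meas (u e) y) (meas (u e) y) / e
    @[e --> (0 : R)^'+] --> l.
Proof.
pose P e i j := pairing (fun d => f (e * d)) (meas (U i) y) (meas (U j) y).
exists (\sum_(i < r) \sum_(j < r) a i * a j * (c (i + j).+1 *
  pairing (fun d => d ^+ (i + j).+1) (meas (U i) y) (meas (U j) y))).
have h : \sum_i \sum_j a i * a j * ((e ^- (i + j) * P e i j - W i j) / e)
    @[e --> (0 : R)^'+] --> \sum_(i < r) \sum_(j < r) a i * a j * (c (i + j).+1 *
  pairing (fun d => d ^+ (i + j).+1) (meas (U i) y) (meas (U j) y)).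
  apply: cvg_sum_list => i; apply: cvg_sum_list => j.
  apply: cvgM; first exact: cvg_cst.
  by apply: wronskian_next_cvg;
    first [exact: (vanishing_dual U_dual) | exact: (moment_dual_self _ U_dual)].
apply: cvg_trans h; apply: near_eq_cvg; near=> e.
rewrite pairing_row_comb -[LHS]addr0.
transitivity ((\sum_i \sum_j a i * a j * (e ^- (i + j) * P e i j)
   - \sum_i \sum_j a i * a j * W i j) / e).
  rewrite -sumrB big_distrl addr0; apply: eq_bigr => i _.
  rewrite -sumrB big_distrl; apply: eq_bigr => j _ /=; ring.
rewrite a_null subr0; congr (_ / _); apply: eq_bigr => i _; apply: eq_bigr => j _.
by rewrite exprD invfM /P; ring.
Unshelve. all: by end_near. Qed.

Let h : {poly R} := \sum_i a i *: (taylor_poly f (4 * r * r))^`N(i).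

(** The polynomial h is a truncated Taylor expansion of sum_i a_i f^(i)(t)/i!. Pair the
    null measure at scale e with the unit mass at -t: since the y k are
    nonnegative, the distances t + e y_k have no absolute values. The result
    X t is small by Cauchy-Schwarz, and it is h(t) up to a multiple of e and a
    Taylor remainder multiplied by weights of size e^(- i), i < r. All three
    errors are o(t^(2r-1)) if e = t^(4r) and the Taylor polynomial has order
    K = 4r^2: indeed 4r - 2 (2r - 1) > 0, 4r > 2r - 1 and
    4r^2 - 4r (r - 1) > 2r - 1. *)
Lemma null_polynomial_small : h.[t] / t ^+ (2 * r - 1) @[t --> (0 : R)^'+] --> (0 : R).
Proof.
have r_gt0 := smoothness_gt0 f_order.
set p := (4 * r)%N; set n := (2 * r - 1)%N; set K := (4 * r * r)%N.
pose P := taylor_poly f K; pose e t : R := t ^+ p.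
have e_cvg : e t @[t --> (0 : R)^'+] --> (0 : R)^'+ by apply: cvg_exp_at_right0; lia.
pose X t := \sum_k u (e t) k * f (t + e t * y k).
pose N s := pairing (fun d => f (s * d)) (meas (u s) y) (meas (u s) y).
have X_cvg : X t / t ^+ n @[t --> (0 : R)^'+] --> (0 : R).
  have [l N_cvg] := null_norm_cvg.
  have bound_cvg : N (e t) / e t * f 0 * 'X^2.[t] @[t --> (0 : R)^'+] --> (l * f 0 * 'X^2.[0] : R).
    apply: cvgM; last exact: cvg_at_right0_poly.
    by apply: cvgM; [exact: (cvg_comp _ _ e_cvg N_cvg)|exact: cvg_cst].
  rewrite hornerXn expr0n mulr0 in bound_cvg.
  have sqr_cvg : (X t / t ^+ n) ^+ 2 @[t --> (0 : R)^'+] --> (0 : R).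
    apply: (squeeze_cvgr _ (cvg_cst (0 : R)) bound_cvg); near=> t.
    have t_gt0 : 0 < t by [].
    have e_gt0 : 0 < e t by rewrite exprn_gt0.
    rewrite sqr_ge0 /= hornerXn.
    have := pairing_CauchySchwarz (dilate_meas (e t) (meas (u (e t)) y))
      [:: (1, - t)] kappa_pd kappa_stat.
    rewrite pairing_dilate ?(ltW e_gt0) // -/(N _).
    have -> : pairing f [:: (1, - t)] [:: (1, - t)] = f 0.
      by rewrite /pairing !big_seq1 /= subrr normr0 !mul1r.
    have -> : pairing f (dilate_meas (e t) (meas (u (e t)) y)) [:: (1, - t)] = X t.
      rewrite /pairing big_map big_meas; apply: eq_bigr => k _ /=.
      rewrite big_seq1 /= mulr1 opprK addrC ger0_norm // addr_ge0 ?mulr_ge0 ?(ltW t_gt0) ?(ltW e_gt0) //.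
    have eE : e t = (t ^+ n) ^+ 2 * t ^+ 2.
      by rewrite /e -exprM -exprD /p /n; congr (_ ^+ _); lia.
    rewrite expr_div_n ler_pdivrMr ?exprn_gt0 //; move=> h1; apply: le_trans h1 _.
    rewrite le_eqVlt; apply/orP; left; apply/eqP.
    have -> : N (e t) / e t * f 0 * t ^+ 2 * (t ^+ n) ^+ 2 =
      N (e t) * f 0 * (((t ^+ n) ^+ 2 * t ^+ 2) / e t) by ring.
    by rewrite -eE divff ?mulr1 // gt_eqF.
  apply/norm_cvg0P.
  have : Num.sqrt ((X t / t ^+ n) ^+ 2) @[t --> (0 : R)^'+] --> (Num.sqrt 0 : R).
    exact: (cvg_comp _ _ sqr_cvg (@sqrt_continuous R 0)).
  by rewrite sqrtr0; under eq_fun => t do rewrite sqrtr_sqr.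
(* q collects the moments of index b >= r; the exponents are positive, as b > i. *)
pose q : {poly R} := \sum_(i < r) \sum_(b < K | (r <= b)%N)
   (a i * moment b (meas (U i) y)) *: (P^`N(b) * 'X^(p * (b - i) - n)).
have q_cvg : q.[t] @[t --> (0 : R)^'+] --> (0 : R).
  suff q0 : q.[0] = 0 by rewrite -[X in _ --> X]q0; exact: cvg_at_right0_poly.
  rewrite horner_sum big1 // => i _; rewrite horner_sum big1 // => b rb.
  rewrite hornerZ hornerM hornerXn expr0n gtn_eqF ?mulr0 //.
  by have := ltn_ord i; rewrite /p /n; nia.
pose rem t := \sum_k u (e t) k * (f (t + e t * y k) - P.[t + e t * y k]).
have rem_cvg : rem t / t ^+ n @[t --> (0 : R)^'+] --> (0 : R).
  have -> : (fun t => rem t / t ^+ n) = (fun t => \sum_i \sum_k a i * U i k *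
      ((e t) ^- i * (f (t + e t * y k) - P.[t + e t * y k]) / t ^+ n)).
    apply/funext => t; rewrite /rem sum_row_comb big_distrl; apply: eq_bigr => i _.
    by rewrite big_distrr big_distrl; apply: eq_bigr => k _ /=; ring.
  have sum0 : \sum_(i < r) \sum_(k < r) a i * U i k * 0 = 0 :> R.
    by rewrite big1 // => i _; rewrite big1 // => k _; rewrite mulr0.
  rewrite -[X in _ --> X]sum0.
  apply: cvg_sum_list => i; apply: cvg_sum_list => k.
  apply: cvgM; first exact: cvg_cst.
  have [C [d [C_ge0 d_gt0 hC]]] := taylor_poly_remainder K f_analytic.
  have y1 : 0 < 1 + y k by rewrite ltr_pwDl.
  pose B := C * (1 + y k) ^+ K.
  have near_d : \forall t \near (0 : R)^'+, t <= d / (1 + y k).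
    by apply: nbhs_right_le; exact: divr_gt0.
  have B_cvg (b : R) : b * t @[t --> (0 : R)^'+] --> (0 : R).
    have := @cvg_at_right0_poly R (b *: 'X); rewrite !hornerE ?mulr0.
    by under eq_fun do rewrite !hornerE.
  apply: (squeeze_cvgr _ (B_cvg (- B)) (B_cvg B)); near=> t.
  have t_gt0 : 0 < t by [].
  have t_le1 : t <= 1 by near: t; exact: nbhs_right_le.
  have et : e t <= t by rewrite /e -[leRHS]expr1 ler_wiXn2l ?(ltW t_gt0) // /p; lia.
  have e_gt0 : 0 < e t by rewrite exprn_gt0.
  have tau_ge0 : 0 <= t + e t * y k by rewrite addr_ge0 ?mulr_ge0 // ltW.
  have tau_le : t + e t * y k <= t * (1 + y k).
    by rewrite mulrDr mulr1 lerD2l ler_wpM2r.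
  have tau_d : t + e t * y k <= d.
    apply: le_trans tau_le _; rewrite -ler_pdivlMr //.
    by near: t; exact: near_d.
  have := hC _ (introT andP (conj tau_ge0 tau_d)); rewrite -/P => hR.
  have ei_gt0 : 0 < e t ^+ i by rewrite exprn_gt0.
  have tn_gt0 : 0 < t ^+ n by rewrite exprn_gt0.
  rewrite mulNr -ler_norml !normrM !normfV (gtr0_norm ei_gt0) (gtr0_norm tn_gt0).
  rewrite ler_pdivrMr // mulrC ler_pdivrMr //.
  apply: (le_trans hR).
  apply: (@le_trans _ _ (C * (t * (1 + y k)) ^+ K)).
    have ty_ge0 : 0 <= t * (1 + y k) by rewrite mulr_ge0 ?(ltW t_gt0) ?(ltW y1).
    by apply: ler_wpM2l => //; apply: lerXn2r.
  have -> : B * t * t ^+ n * e t ^+ i = C * (1 + y k) ^+ K * t ^+ (1 + n + p * i).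
    by rewrite /B /e -exprM !exprD expr1; ring.
  rewrite exprMn mulrCA mulrC; apply: ler_wpM2l.
    by rewrite mulr_ge0 // exprn_ge0 // (ltW y1).
  apply: ler_wiXn2l; rewrite ?(ltW t_gt0) //.
  by have := ltn_ord i; rewrite /n /p /K; nia.
have : X t / t ^+ n - q.[t] - rem t / t ^+ n @[t --> (0 : R)^'+] --> (0 - 0 - 0 : R).
  by apply: cvgB => //; apply: cvgB.
rewrite !subr0; apply: cvg_trans; apply: near_eq_cvg; near=> t.
have t_neq0 : t != 0 by rewrite gt_eqF.
have t_gt0 : 0 < t by [].
have e_neq0 : e t != 0 by rewrite expf_neq0.
suff E : X t - rem t = h.[t] + t ^+ n * q.[t].
  have -> : h.[t] = X t - rem t - t ^+ n * q.[t] by rewrite E addrK.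
  have tn_neq0 : t ^+ n != 0 by rewrite expf_neq0.
  by rewrite !mulrBl mulrAC divff // mul1r addrAC.
rewrite /X /rem -sumrB.
transitivity (\sum_k u (e t) k * P.[t + e t * y k]).
  by apply: eq_bigr => k _; ring.
rewrite sum_row_comb horner_sum horner_sum mulr_sumr -big_split /=.
apply: eq_bigr => i _.
have size_P : (size P <= K)%N by exact: size_poly.
pose G b := moment b (meas (U i) y) * (e t ^- i * e t ^+ b * P^`N(b).[t]).
transitivity (a i * \sum_(b < K) G b).
  rewrite -mulrA; congr (_ * _); rewrite mulr_sumr.
  under eq_bigr => k _.
    rewrite (nderiv_taylor_wide (mulrC _ _) size_P) !mulr_sumr; over.
  rewrite exchange_big; apply: eq_bigr => b _ /=.
  rewrite /G moment_meas big_distrl; apply: eq_bigr => k _ /=.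
  by rewrite exprMn; ring.
(* Below index r the moments are Kronecker symbols, and only h is left. *)
rewrite (bigID (fun b : 'I_K => (r <= b)%N)) /= mulrDr addrC; congr (_ + _); last first.
  have iK : (i < K)%N by have := ltn_ord i; rewrite /K; nia.
  rewrite (bigD1 (Ordinal iK)) -?ltnNge //= big1 ?addr0 => [|b].
    by rewrite /G (moment_dual_self _ U_dual) mul1r mulVf ?expf_neq0 // mul1r hornerZ.
  rewrite -ltnNge => /andP[br bi].
  rewrite /G (moment_dual _ U_dual) // (_ : _ == _ = false) ?mul0r //.
  by apply: contraNF bi => /eqP ib; apply/eqP/val_inj.
rewrite horner_sum !mulr_sumr; apply: eq_bigr => b rb.
rewrite hornerZ hornerM hornerXn /G.
have -> : e t ^+ b = e t ^+ i * (t ^+ n * t ^+ (p * (b - i) - n)).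
  rewrite -exprD /e -!exprM -exprD; congr (_ ^+ _).
  by have := ltn_ord i; rewrite /p /n; nia.
rewrite mulKf ?expf_neq0 //; ring.
Unshelve. all: by end_near. Qed.
End NullCombination.

(** The points 0, ..., r - 1 serve as the nonnegative points of the test measure. *)
Lemma null_combination_coef (a : 'I_r -> R) :
  \sum_i \sum_j a i * a j * W i j = 0 ->
  forall l, (l <= 2 * r - 1)%N -> \sum_i a i * 'C(i + l, i)%:R * c (i + l) = 0.
Proof.
move=> a_null l lr; pose y (k : 'I_r) : R := (nat_of_ord k)%:R.
have y_inj : injective y by move=> i j /eqP; rewrite eqr_nat => /eqP/val_inj.
have [U U_dual] := dual_basis y_inj.
have y0 k : 0 <= y k by exact: ler0n.
have := small_poly_coef_eq0 (null_polynomial_small y0 U_dual a_null) lr.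
rewrite coef_sum => h0; rewrite -[RHS]h0; apply: eq_bigr => i _.
rewrite coefZ coef_nderivn coef_poly ifT; last by have := ltn_ord i; nia.
by rewrite [RHS]mulrnAr -[RHS]mulr_natl /c; ring.
Qed.

(** As W i j = 0 for odd i + j, a null vector v may be replaced by (-1)^i v_i, so
    that the coefficient relations hold for the even and the odd part of v
    separately. Let q be the largest index with v_q != 0. In the relation of
    order l = 2r - 1 - q for the part of the parity of q, the indices i < q give
    odd coefficients below 2r - 1, which vanish, and q gives f_(2r-1). *)
Lemma wronskian_unit : \det W != 0.
Proof.
apply/negP => /det0P[v v0 vW].
have null_sum (s : 'I_r -> R) : (forall i, s i ^+ 2 = 1) -> 
    (forall i j : 'I_r, ~~ odd (i + j) -> s i * s j = 1) ->
    \sum_i \sum_j (s i * v 0 i) * (s j * v 0 j) * W i j = 0.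
  move=> s2 ss; transitivity ((v *m W *m v^T) 0 0); last by rewrite vW mul0mx mxE.
  rewrite mxE exchange_big; apply: eq_bigr => j _; rewrite !mxE big_distrl.
  apply: eq_bigr => i _ /=; have [ij|ij] := boolP (odd (i + j)).
    by rewrite wronskian_odd_eq0 // !(mulr0, mul0r).
  by rewrite mulrACA ss // mul1r mulrAC.
have n1 := null_combination_coef (null_sum (fun=> 1) _ _).
have n2 := null_combination_coef (null_sum (fun i => (-1) ^+ i) _ _).
have [i0 vi0] : exists i, v 0 i != 0.
  apply/existsP; rewrite -negb_forall; apply: contra v0 => /forallP v0.
  by apply/eqP/rowP => i; rewrite mxE; apply/eqP.
case: (@arg_maxnP _ i0 (fun i => v 0 i != 0) val vi0) => q vq qmax.
have q_lt := ltn_ord q.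
have lr : (2 * r - 1 - q <= 2 * r - 1)%N by lia.
have {n1} n1 : \sum_i (1 * v 0 i) * 'C(i + (2 * r - 1 - q), i)%:R *
    c (i + (2 * r - 1 - q)) = 0.
  by apply: n1 => // [i|i j _]; rewrite ?expr1n ?mul1r.
have {n2} n2 : \sum_(i < r) ((-1) ^+ i * v 0 i) * 'C(i + (2 * r - 1 - q), i)%:R *
    c (i + (2 * r - 1 - q)) = 0.
  apply: n2 => // [i|i j ij]; first exact: sqrr_sign.
  by rewrite -exprD -signr_odd (negbTE ij).
have : \sum_(i < r) (1 + (-1) ^+ (q + i)) * (v 0 i * 'C(i + (2 * r - 1 - q), i)%:R *
    c (i + (2 * r - 1 - q))) = 0.
  rewrite -[RHS]addr0 -[X in _ = X + _]n1 -[X in _ = _ + X](mulr0 ((-1) ^+ q)).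
  rewrite -[X in _ = _ + _ * X]n2 mulr_sumr -big_split /=; apply: eq_bigr => i _.
  by rewrite exprD; ring.
rewrite (bigD1 q) //= big1 ?addr0 => [|j jq].
  have -> : 1 + (-1) ^+ (q + q) = 2 :> R by rewrite -signr_odd oddD addbb.
  apply/eqP.
  have bin_neq0 : 'C(q + (2 * r - 1 - q), q)%:R != 0 :> R.
    by rewrite pnatr_eq0 -lt0n bin_gt0 leq_addr.
  have c_neq0 : c (q + (2 * r - 1 - q)) != 0.
    by rewrite subnKC; [case: f_order|lia].
  by apply: (mulf_neq0 _ (mulf_neq0 (mulf_neq0 vq bin_neq0) c_neq0)); rewrite pnatr_eq0.
move: jq; rewrite -val_eqE neq_ltn /= => /orP[jq|qj]; last first.
  have : ~~ (v 0 j != 0) by apply: contraL qj => /qmax; rewrite -leqNgt.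
  by rewrite negbK => /eqP ->; rewrite !(mul0r, mulr0).
have [ol|el] := boolP (odd (j + (2 * r - 1 - q))).
  by rewrite /c (odd_coef_eq0 f_order) ?mulr0 //; lia.
rewrite -signr_odd (_ : odd (q + j)) ?subrr ?mul0r //; move: el; lia.
Qed.
End Wronskian.

(** * Determinants *)

Section Determinants.
Variable R : realType.

Lemma pdmx_det_neq0 n (A : 'M[R]_n) : pdmx A -> \det A != 0.
Proof.
move=> [Asym Apd]; apply/negP => /det0P[v v0 vA].
have vT0 : v^T != 0 by rewrite -(inj_eq (@trmx_inj _ _ _)) trmxK trmx0.
by have := Apd _ vT0; rewrite trmxK vA mul0mx mxE ltxx.
Qed.

(** The segment from the identity to A consists of positive definite matrices, so
    the determinant, a polynomial in the parameter, has no root on it. *)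
Lemma pdmx_det_gt0 n (A : 'M[R]_n) : pdmx A -> 0 < \det A.
Proof.
move=> Apd; pose M : 'M[{poly R}]_n := (1 - 'X)%:M + 'X *: map_mx polyC A.
have Mt t : (\det M).[t] = \det ((1 - t)%:M + t *: A).
  rewrite -/(horner_eval t (\det M)) -det_map_mx; congr (\det _); apply/matrixP => i j.
  by rewrite !mxE /= /horner_eval !hornerE hornerMn !hornerE.
have M0 : (\det M).[0] = 1 by rewrite Mt subr0 scale0r addr0 det1.
have M1 : (\det M).[1] = \det A by rewrite Mt subrr scale1r (raddf0 (@scalar_mx _ _)) add0r.
rewrite ltNge; apply/negP => detA.
have [||t /andP[t0 t1]] := @poly_ivt R (- \det M) 0 1; first exact: ler01.
  by rewrite !hornerN M0 M1 lerN10 oppr_ge0.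
rewrite rootN /root Mt; apply/negP; apply: pdmx_det_neq0; case: Apd => Asym Apd.
split; first by rewrite linearD linearZ /= tr_scalar_mx Asym.
move=> v v0; rewrite mulmxDr mulmxDl -scalemxAr -scalemxAl mul_mx_scalar -scalemxAl.
rewrite !mxE; have := Apd v v0; rewrite mxE; set q := \sum_j _ => q_gt0.
have : 0 < \sum_j v^T 0 j * v j 0.
  have [i vi] : exists i, v i 0 != 0.
    apply/existsP; rewrite -negb_forall; apply: contra v0 => /forallP v0.
    by apply/eqP/colP => i; rewrite mxE; apply/eqP.
  rewrite (bigD1 i) //= mxE ltr_pwDl //; first by rewrite -expr2 exprn_even_gt0.
  by apply: sumr_ge0 => j _; rewrite mxE -expr2 sqr_ge0.
set s := \sum_j _ => s_gt0.
have [->|t_neq0] := eqVneq t 0; first by lra.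
have : 0 < t by rewrite lt0r t_neq0.
by nra.
Qed.

(** Three unipotent operations lead to a block triangular matrix: adding C B to A;
    subtracting the first block column times C, which turns the zero corner into
    - 1; clearing the upper right block with this - 1. *)
Lemma det_saddle k p (A : 'M[R]_k) (C : 'M[R]_(k, p)) (B : 'M[R]_(p, k)) :
  B *m C = 1%:M ->
  \det (block_mx A C B 0) = (-1) ^+ p * \det (A *m (1%:M - C *m B) + C *m B).
Proof.
move=> BC.
have E1 : block_mx A C B 0 *m block_mx 1%:M 0 B 1%:M = block_mx (A + C *m B) C B 0.
  by rewrite mulmx_block !mulmx1 !mulmx0 !mul0mx !addr0 add0r.
have E2 : block_mx (A + C *m B) C B 0 *m block_mx 1%:M (- C) 0 1%:M =
    block_mx (A + C *m B) (- (A *m C)) B (- 1%:M).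
  rewrite mulmx_block !mulmx1 !mulmx0 !addr0 !mulmxN BC mulmxDl -mulmxA BC mulmx1.
  by rewrite opprD addrNK.
have E3 : block_mx 1%:M (- (A *m C)) 0 1%:M *m
    block_mx (A + C *m B) (- (A *m C)) B (- 1%:M) =
    block_mx (A *m (1%:M - C *m B) + C *m B) 0 B (- 1%:M).
  rewrite mulmx_block !mul1mx !mul0mx !add0r mulmxN mulmx1 opprK addNr.
  by rewrite mulNmx mulmxBr mulmx1 mulmxA addrAC.
have := congr1 determinant E3.
rewrite -E2 -E1 !det_mulmx !det_ublock !det_lblock !det1 !(mul1r, mulr1) => ->.
have -> : \det (- 1%:M : 'M[R]_p) = (-1) ^+ p by rewrite -scaleN1r detZ det1 mulr1.
by rewrite mulrC.
Qed.

Lemma cvg_det (T : Type) (F : set_system T) (FF : Filter F) n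
    (A : T -> 'M[R]_n) (B : 'M[R]_n) :
  (forall i j, A t i j @[t --> F] --> B i j) -> \det (A t) @[t --> F] --> \det B.
Proof.
move=> AB; apply: cvg_sum_list => s; apply: cvgM; first exact: cvg_cst.
apply: cvg_big => [|i _]; [exact: mul_continuous|exact: AB].
Qed.

Lemma det_row_col_scale n (a b : 'I_n -> R) (A : 'M[R]_n) :
  \det (\matrix_(i, j) (a i * A i j * b j)) = (\prod_i a i) * \det A * \prod_i b i.
Proof.
have -> : \matrix_(i, j) (a i * A i j * b j) =
    diag_mx (\row_i a i) *m A *m diag_mx (\row_i b i).
  by apply/matrixP => i j; rewrite mul_mx_diag mul_diag_mx !mxE.
rewrite !det_mulmx !det_diag; congr (_ * _ * _); apply: eq_bigr => i _; by rewrite mxE.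
Qed.
End Determinants.

Section Saddle.
Variable R : realType.

Lemma conj_pairing n (g : R -> R) (y : 'I_n -> R) (U : 'M[R]_n) i j :
  (U *m (\matrix_(k, l) g `|y k - y l|) *m U^T) i j =
  pairing g (meas (U i) y) (meas (U j) y).
Proof.
rewrite pairing_meas mxE exchange_big; apply: eq_bigr => l _ /=.
rewrite !mxE big_distrl; apply: eq_bigr => k _ /=.
by rewrite !mxE mulrAC.
Qed.

Definition saddle_weight n p (A : 'M[R]_n) (V : 'M[R]_(n, p)) : R :=
  (-1) ^+ p * \det (block_mx A V V^T 0).

(** In the dual basis V becomes the first r + 1 coordinate vectors, so that bordering
    by V deletes the corresponding rows and columns. *)
Lemma saddle_weight_dual r s (y : 'I_(r.+1 + s) -> R) (U A : 'M[R]_(r.+1 + s)) :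
  U *m (Vandermonde (r.+1 + s) (\row_i y i))^T = 1%:M ->
  saddle_weight A (vandermonde_le r y) * \det U ^+ 2 =
  \det (drsubmx (U *m A *m U^T)).
Proof.
move=> U_dual; set V := vandermonde_le r y.
have UV : U *m V = col_mx 1%:M 0.
  apply/matrixP => i j; have /matrixP/(_ i (lshift s j)) := U_dual.
  rewrite !mxE; under eq_bigr => k _ do rewrite !mxE.
  under [in X in _ -> X]eq_bigr => k _ do rewrite !mxE.
  move=> ->; case: split_ordP => a ->; rewrite !mxE ?eq_shift //.
set C := col_mx 1%:M 0 in UV.
have E : block_mx U 0 0 1%:M *m block_mx A V V^T 0 *m (block_mx U 0 0 1%:M)^T =
    block_mx (U *m A *m U^T) C C^T 0.
  rewrite tr_block_mx !trmx0 trmx1 !mulmx_block.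
  by rewrite !(mulmx0, mul0mx, addr0, add0r, mulmx1, mul1mx) -trmx_mul UV.
have := congr1 determinant E; rewrite !det_mulmx det_tr det_lblock det1 mulr1.
have CC : C^T *m C = 1%:M by rewrite tr_col_mx mul_row_col trmx1 trmx0 mulmx1 mul0mx addr0.
rewrite (det_saddle _ CC) /saddle_weight => h.
transitivity ((-1) ^+ r.+1 * (\det U * \det (block_mx A V V^T 0) * \det U)); first by ring.
rewrite h mulrA -expr2 sqrr_sign mul1r.
have -> : C *m C^T = block_mx 1%:M 0 0 0.
  by rewrite tr_col_mx mul_col_row trmx1 trmx0 !mulmx0 !mul0mx mulmx1.
rewrite -[U *m A *m U^T in LHS]submxK scalar_mx_block opp_block_mx add_block_mx.
rewrite !oppr0 !addr0 subrr mulmx_block !mulmx0 !mulmx1 !addr0 !add0r add_block_mx.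
by rewrite !add0r !addr0 det_ublock det1 mul1r.
Qed.
End Saddle.

Section FlatDeterminant.
Variable R : realType.
Variables (f : R -> R) (r' : nat).
Let r := r'.+1.
Hypotheses (f_analytic : analytic_at0 f) (f_order : smoothness_order f r).
Variable kappa : R -> R -> R.
Hypotheses (kappa_pd : pd_kernel kappa) (kappa_stat : stationary kappa f).
Let c := taylor_coef f.

Section Points.
Variables (s : nat) (y : 'I_(r + s) -> R).
Hypothesis y_inj : injective y.

Let A := (-1) ^+ r *: dist_mx (2 * r - 1) y.
Let V := vandermonde_le r' y.

(** Up to a square, the weight is the determinant of the form (-1)^r |x - y|^(2r-1)
    on the dual measures of index >= r, which have r vanishing moments. *)
Lemma saddle_weight_gt0 : 0 < saddle_weight A V.
Proof.
have [U U_dual] := dual_basis y_inj.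
have [U_unit _] := mulmx1_unit U_dual.
have detU : \det U != 0 by rewrite -unitfE -unitmxE.
have detU2 : 0 < \det U ^+ 2 by rewrite exprn_even_gt0.
rewrite -(pmulr_lgt0 _ detU2) (saddle_weight_dual _ U_dual).
set B := U *m A *m U^T.
have BE i j : B i j = (-1) ^+ r * pairing (fun d => d ^+ (2 * r - 1)) (meas (U i) y) (meas (U j) y).
  by rewrite /B /A -scalemxAr -scalemxAl mxE -conj_pairing.
apply: pdmx_det_gt0; split.
  by apply/matrixP => i j; rewrite [LHS]mxE ![drsubmx _ _ _]mxE [dsubmx _ _ _]mxE [in RHS]mxE !BE pairingC.
move=> v v0; pose w : 'cV_(r + s) := col_mx (0 : 'cV_r) v.
have -> : v^T *m drsubmx B *m v = w^T *m B *m w.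
  rewrite -[in RHS](submxK B) /w tr_col_mx trmx0 mul_row_block mul_row_col.
  by rewrite !mul0mx !add0r mulmx0 add0r.
pose z := row_comb (fun i => w i 0) U.
have -> : (w^T *m B *m w) 0 0 = (-1) ^+ r *
    pairing (fun d => d ^+ (2 * r - 1)) (meas z y) (meas z y).
  rewrite pairing_row_comb mxE mulr_sumr; apply: eq_bigr => j _.
  rewrite mxE mulr_suml mulr_sumr; apply: eq_bigr => i _.
  by rewrite BE mxE pairingC; ring.
have hz : vanishing r (meas z y).
  move=> b br; rewrite moment_meas sum_row_comb big1 // => i _.
  rewrite -moment_meas (moment_dual _ U_dual); last by rewrite ltn_addr.
  have [ib|_] := eqVneq (nat_of_ord i) b; last by rewrite mulr0.
  have -> : i = lshift s (Ordinal br) by apply: val_inj.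
  by rewrite /w col_mxEu mxE mul0r.
rewrite lt0r (cond_psd f_analytic f_order kappa_pd kappa_stat hz) andbT.
rewrite mulf_eq0 signr_eq0 /=; apply: contra v0 => /eqP pz.
have z0 := cond_definite f_analytic f_order kappa_pd kappa_stat y_inj hz pz.
have : w^T *m U = 0.
  apply/rowP => k; rewrite !mxE -[RHS](z0 k); apply: eq_bigr => i _; by rewrite mxE.
move=> /(congr1 (mulmx^~ (invmx U))); rewrite mulmxK // mul0mx => /(congr1 trmx).
by rewrite trmxK trmx0 => /eqP; rewrite /w col_mx_eq0 eqxx.
Qed.

(** The total power of e taken out by scaling row i by e^(- min(i, r - 1)) and
    column j by e^(- min(j, r)). *)
Definition flat_exponent k := (\sum_(i < k) (minn i r' + minn i r))%N.

(** Scaling the columns one step beyond the rows gives every block an integral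
    exponent at most 2r - 1: the two diagonal blocks get their leading orders,
    the lower left block one less than its order, so that it tends to 0, and the
    upper right block just converges. *)
Lemma det_kernel_flat_cvg :
  e ^- flat_exponent (r + s) * \det (kernel_mx (scaled_kernel f e) y)
    @[e --> (0 : R)^'+] -->
  \det (wronskian_mx f r) * ((-1) ^+ r * c (2 * r - 1)) ^+ s * saddle_weight A V.
Proof.
have [U U_dual] := dual_basis y_inj.
have [U_unit _] := mulmx1_unit U_dual.
have detU : \det U != 0 by rewrite -unitfE -unitmxE.
have detU2 : \det U ^+ 2 != 0 by rewrite expf_neq0.
pose D := dist_mx (2 * r - 1) y.
pose p (i : nat) := minn i r'; pose q (i : nat) := minn i r.
pose S e : 'M[R]_(r + s) := U *m kernel_mx (scaled_kernel f e) y *m U^T.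
pose T : 'M[R]_(r + s) := \matrix_(i, j) (c (p i + q j) *
  pairing (fun d => d ^+ (p i + q j)) (meas (U i) y) (meas (U j) y)).
have SE e i j : S e i j = pairing (fun d => f (e * d)) (meas (U i) y) (meas (U j) y).
  exact: (conj_pairing (fun d => f (e * d))).
have row_vanishing (i : 'I_(r + s)) : vanishing (q i) (meas (U i) y).
  by apply: vanishingW _ (vanishing_dual U_dual); rewrite geq_minl.
have T_cvg : \det (\matrix_(i, j) (e ^- p i * S e i j * e ^- q j)) @[e --> (0 : R)^'+]
    --> \det T.
  apply: cvg_det => i j; rewrite [T i j]mxE.
  have pq_q : (p i + q j <= q i + q j)%N by rewrite leq_add2r /p /q; lia.
  have pq_r : (p i + q j <= 2 * r - 1)%N by rewrite /p /q /r; lia.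
  have := pairing_order_cvg f_analytic f_order (row_vanishing i) (row_vanishing j) pq_q pq_r.
  apply: cvg_trans; apply: near_eq_cvg; near=> e.
  by rewrite mxE SE exprD invfM; ring.
have TE : T = block_mx (wronskian_mx f r) (ursubmx T) 0
    (c (2 * r - 1) *: drsubmx (U *m D *m U^T)).
  rewrite -[LHS]submxK; congr block_mx; apply/matrixP => i j; rewrite 3![LHS]mxE /=.
  - have [pi qj] : p i = i /\ q j = j.
      by rewrite /p /q; have := ltn_ord i; have := ltn_ord j; rewrite /r; lia.
    rewrite pi qj; apply: (wronskianE f_order) => //.
    + exact: (vanishing_dual (i := lshift s i) U_dual).
    + exact: (vanishing_dual (i := lshift s j) U_dual).
    + by rewrite (moment_dual _ U_dual) ?eqxx // ltn_addr.
    + by rewrite (moment_dual _ U_dual) ?eqxx // ltn_addr.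
  - have [pi qj] : p (r + i)%N = r' /\ q j = j.
      by rewrite /p /q; have := ltn_ord j; rewrite /r; lia.
    rewrite [RHS]mxE pi qj; apply: (pairing_lower_eq0 f_order (i := r) (j := j)).
    + have := row_vanishing (rshift r i); rewrite /q /= (minn_idPr _) //.
      exact: leq_addr.
    + exact: (vanishing_dual (i := lshift s j) U_dual).
    + by rewrite /r; lia.
    + by have := ltn_ord j; rewrite /r; lia.
  have [pi qj] : p (r + i)%N = r' /\ q (r + j)%N = r by rewrite /p /q /r; lia.
  rewrite pi qj [RHS]mxE [drsubmx _ _ _]mxE [dsubmx _ _ _]mxE (conj_pairing (fun d => d ^+ (2 * r - 1))).
  by rewrite (_ : r' + r = 2 * r - 1)%N // /r; lia.
have detTE : \det T = \det U ^+ 2 *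
    (\det (wronskian_mx f r) * ((-1) ^+ r * c (2 * r - 1)) ^+ s * saddle_weight A V).
  rewrite TE det_ublock detZ -mulrA [RHS]mulrCA; congr (_ * _).
  rewrite mulrCA (mulrC (\det U ^+ 2)) (saddle_weight_dual _ U_dual).
  rewrite /A -scalemxAr -scalemxAl /drsubmx !linearZ /= detZ mulrA -exprMn mulrAC -expr2.
  by rewrite sqrr_sign mul1r.
rewrite -[X in _ --> X](mulKf detU2) -detTE mulrC.
have : \det (\matrix_(i, j) (e ^- p i * S e i j * e ^- q j)) * (\det U ^+ 2)^-1
    @[e --> (0 : R)^'+] --> \det T * (\det U ^+ 2)^-1.
  by apply: cvgM => //; exact: cvg_cst.
apply: cvg_trans; apply: near_eq_cvg; near=> e.
rewrite (det_row_col_scale (fun i => e ^- p i) (fun j => e ^- q j)).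
rewrite /S !det_mulmx det_tr !prodfV !prodrXr /flat_exponent big_split exprD invfM /=.
rewrite /p /q; field; rewrite !expf_neq0 // gt_eqF //.
Unshelve. all: by end_near. Qed.
End Points.
End FlatDeterminant.

(** * Laws and their weights *)

Lemma exists_law (R : realType) n (w : {set 'I_n} -> R) :
  (forall X, 0 <= w X) -> 0 < \sum_X w X ->
  exists P, is_law P /\ proportional P w.
Proof.
move=> w_ge0 W_gt0; exists (fun X => (\sum_Y w Y)^-1 * w X); split; last first.
  by exists (\sum_Y w Y)^-1.
split=> [X|]; first by rewrite mulr_ge0 // invr_ge0 ltW.
by rewrite -mulr_sumr mulVf // gt_eqF.
Qed.

(** The proportionality constant is forced, as the total mass is 1. *)
Lemma law_of_proportional (R : realType) n (P w : {set 'I_n} -> R) :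
  is_law P -> proportional P w ->
  \sum_X w X != 0 /\ forall X, P X = w X / \sum_Y w Y.
Proof.
move=> [_ P1] [c Pc]; have cW : c * \sum_X w X = 1.
  by rewrite -P1 mulr_sumr; apply: eq_bigr => X _; rewrite Pc.
have W0 : \sum_X w X != 0.
  by apply/eqP => W0; move/eqP: cW; rewrite W0 mulr0 eq_sym oner_eq0.
have cE : c = (\sum_X w X)^-1 by apply: (mulIf W0); rewrite cW mulVf.
by split=> // X; rewrite Pc mulrC cE.
Qed.

Lemma sum_card_weight_gt0 (R : realType) n m (w : {set 'I_n} -> R) :
  (m <= n)%N -> (forall X : {set 'I_n}, #|X| = m -> 0 < w X) ->
  (forall X : {set 'I_n}, 0 <= if #|X| == m then w X else 0) /\
  0 < \sum_(X : {set 'I_n}) (if #|X| == m then w X else 0).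
Proof.
move=> mn w_gt0; have ge0 (X : {set 'I_n}) : 0 <= if #|X| == m then w X else 0.
  by case: eqP => // /w_gt0/ltW.
split=> //; pose X0 : {set 'I_n} := imset (widen_ord mn) (mem [set: 'I_m]%SET).
have X0m : #|X0| = m.
  by rewrite card_imset ?cardsT ?card_ord // => i j [] /val_inj.
by rewrite (bigD1 X0) //= X0m eqxx ltr_pwDl ?w_gt0 // sumr_ge0.
Qed.

Section Restriction.
Variables (R : realType) (n : nat) (x : 'I_n -> R) (X : {set 'I_n}).

Definition restrict (i : 'I_#|X|) : R := x (enum_val i).

Lemma restrict_inj : injective x -> injective restrict.
Proof. by move=> x_inj i j /x_inj/enum_val_inj. Qed.

Lemma principal_kernel_mx k :
  principal_submx (kernel_mx k x) X = kernel_mx k restrict.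
Proof. by apply/matrixP => i j; rewrite !mxE. Qed.

Lemma principal_dist_mx (a : R) s :
  principal_submx (a *: dist_mx s x) X = a *: dist_mx s restrict.
Proof. by apply/matrixP => i j; rewrite !mxE. Qed.

Lemma rows_vandermonde k :
  rows_submx (vandermonde_le k x) X = vandermonde_le k restrict.
Proof. by apply/matrixP => i j; rewrite !mxE. Qed.
End Restriction.

Lemma scaled_kernel_mx_pd (R : realType) n (kappa : R -> R -> R) f e (y : 'I_n -> R) :
  pd_kernel kappa -> stationary kappa f -> 0 < e -> injective y ->
  pdmx (kernel_mx (scaled_kernel f e) y).
Proof.
move=> kpd kst e_gt0 y_inj.
have -> : kernel_mx (scaled_kernel f e) y = kernel_mx kappa (fun i => e * y i).
  apply/matrixP => i j; rewrite !mxE kst /scaled_kernel.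
  by rewrite -mulrBr normrM gtr0_norm.
have e_neq0 : e != 0 by rewrite gt_eqF.
by apply: kpd => i j /(mulfI e_neq0)/y_inj.
Qed.

Lemma pdmx_psd (R : realType) n (A : 'M[R]_n) : pdmx A -> psdmx A.
Proof.
move=> [Asym Apd]; split=> // v; have [->|/Apd/ltW//] := eqVneq v 0.
by rewrite mulmx0 mxE.
Qed.

Lemma rank_vandermonde_le (R : realType) n r (y : 'I_n -> R) : injective y ->
  (r < n)%N -> \rank (vandermonde_le r y) = r.+1.
Proof.
move=> y_inj rn; have [U U_dual] := dual_basis y_inj.
apply/eqP; apply/row_fullP; exists (rowsub (widen_ord rn) U).
apply/matrixP => i j; have /matrixP/(_ (widen_ord rn i) (widen_ord rn j)) := U_dual.
rewrite !mxE -[RHS]/((i == j)%:R) => <-.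
by apply: eq_bigr => k _; rewrite !mxE.
Qed.

Theorem theorem4p8 (R : realType) (n m r : nat) (x : 'I_n -> R)
    (kappa : R -> R -> R) (f : R -> R)
    (x_inj : injective x) (m_ge1 : (1 <= m)%N) (m_le_n : (m <= n)%N)
    (kappa_pd : pd_kernel kappa) (kappa_stat : stationary kappa f)
    (f_analytic : analytic_at0 f)
    (f_order : smoothness_order f r) (r_le_m : (r <= m)%N) :
  let L (eps : R) := kernel_mx (scaled_kernel f eps) x in
  let D := (-1) ^+ r *: dist_mx (2 * r - 1)%N x in
  let V := vandermonde_le r.-1 x in
  (forall eps : R, 0 < eps ->
     exists P : {set 'I_n} -> R, fixed_size_dpp m (L eps) P) /\
  (exists P : {set 'I_n} -> R, fixed_size_pp_dpp m D V P) /\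
  (forall (P_ : R -> {set 'I_n} -> R) (Pstar : {set 'I_n} -> R),
     (forall eps : R, 0 < eps -> fixed_size_dpp m (L eps) (P_ eps)) ->
     fixed_size_pp_dpp m D V Pstar ->
     forall X : {set 'I_n}, P_ eps X @[eps --> 0^'+] --> Pstar X).
Proof.
have r_gt0 := smoothness_gt0 f_order.
case: r => // r' in f_order r_le_m r_gt0 *; set r := r'.+1 in f_order r_le_m *.
have [s mE] : exists s, m = (r + s)%N by exists (m - r)%N; rewrite subnKC.
subst m; rewrite [r.-1]/=; move=> L D V.
split=> [e e_gt0|].
  have L_pd := scaled_kernel_mx_pd kappa_pd kappa_stat e_gt0 x_inj.
  have [|w_ge0 W_gt0] := @sum_card_weight_gt0 _ _ _
    (fun X : {set 'I_n} => \det (principal_submx (L e) X)) m_le_n.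
    move=> X _; rewrite principal_kernel_mx; apply: pdmx_det_gt0.
    exact: scaled_kernel_mx_pd kappa_pd kappa_stat e_gt0 (restrict_inj x_inj).
  have [P [P_law P_prop]] := exists_law w_ge0 W_gt0.
  by exists P; split=> //; exact: pdmx_psd.
pose wS (X : {set 'I_n}) := saddle_weight (principal_submx D X) (rows_submx V X).
have wS_gt0 (X : {set 'I_n}) : #|X| = (r + s)%N -> 0 < wS X.
  move=> Xm; rewrite /wS principal_dist_mx rows_vandermonde.
  have := restrict_inj (X := X) x_inj; move: (@restrict _ _ x X); rewrite Xm.
  by move=> y y_inj; exact: (saddle_weight_gt0 f_analytic f_order kappa_pd kappa_stat).
split.
  have [w_ge0 W_gt0] := sum_card_weight_gt0 m_le_n wS_gt0.
  have [P [P_law P_prop]] := exists_law w_ge0 W_gt0.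
  exists P; split=> //.
    split; last by apply: rank_vandermonde_le => //; exact: leq_trans m_le_n.
    by apply/matrixP => i j; rewrite !mxE distrC.
  move=> v Vv; have hv : vanishing r (meas (fun i => v i 0) x).
    move=> b br; have /matrixP/(_ (Ordinal br) 0) := Vv; rewrite !mxE => <-.
    by rewrite moment_meas; apply: eq_bigr => i _; rewrite !mxE mulrC.
  have := cond_psd f_analytic f_order kappa_pd kappa_stat hv; congr (_ <= _).
  rewrite pairing_meas mxE exchange_big mulr_sumr; apply: eq_bigr => j _.
  rewrite mxE mulr_suml mulr_sumr; apply: eq_bigr => i _; rewrite !mxE; ring.
move=> P_ Pstar P_dpp [_ _ Pstar_law Pstar_prop] X.
pose wL e (X : {set 'I_n}) := if #|X| == (r + s)%N then \det (principal_submx (L e) X) else 0.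
pose w (X : {set 'I_n}) := if #|X| == (r + s)%N then wS X else 0.
have [W_neq0 PstarE] := law_of_proportional Pstar_law (Pstar_prop : proportional Pstar w).
pose C := \det (wronskian_mx f r) * ((-1) ^+ r * taylor_coef f (2 * r - 1)) ^+ s.
have C_neq0 : C != 0.
  rewrite mulf_neq0 ?(wronskian_unit f_analytic f_order kappa_pd kappa_stat) //.
  by rewrite expf_neq0 // gt_eqF // (signed_coef_gt0 f_analytic f_order kappa_pd kappa_stat).
have wL_cvg Y : e ^- flat_exponent r' (r + s) * wL e Y @[e --> (0 : R)^'+] --> C * w Y.
  rewrite /wL /w; case: eqP => [Ym|_]; last first.
    by rewrite mulr0; under eq_fun do rewrite mulr0; exact: cvg_cst.
  rewrite /wS principal_dist_mx rows_vandermonde.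
  under eq_fun do rewrite principal_kernel_mx.
  have := restrict_inj (X := Y) x_inj; move: (@restrict _ _ x Y); rewrite /C Ym.
  by move=> y y_inj; exact: (det_kernel_flat_cvg f_analytic f_order).
have Z_cvg : \sum_Y e ^- flat_exponent r' (r + s) * wL e Y @[e --> (0 : R)^'+] --> \sum_Y C * w Y.
  exact: cvg_sum_list.
have CW_neq0 : \sum_Y C * w Y != 0 by rewrite -mulr_sumr mulf_neq0.
have -> : Pstar X = C * w X / \sum_Y C * w Y.
  by rewrite PstarE -mulr_sumr -mulf_div divff // mul1r.
have : (e ^- flat_exponent r' (r + s) * wL e X) / (\sum_Y e ^- flat_exponent r' (r + s) * wL e Y)
    @[e --> (0 : R)^'+] --> C * w X / \sum_Y C * w Y.
  by apply: cvgM; [exact: wL_cvg|apply: cvgV].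
apply: cvg_trans; apply: near_eq_cvg; near=> e.
have e_gt0 : 0 < e by [].
have [_ P_law P_prop] := P_dpp e e_gt0.
have [_ ->] := law_of_proportional P_law (P_prop : proportional (P_ e) (wL e)).
have E_neq0 : e ^- flat_exponent r' (r + s) != 0 by rewrite invr_neq0 // expf_neq0 // gt_eqF.
by rewrite /= -mulr_sumr -mulf_div divff // mul1r.
Unshelve. all: by end_near. Qed.
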